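(* Let $p\in[2,\infty)$ and for each $n\in\mathbb N$ let $X^{(n,p)}$ be uniformly distributed on $n^{1/p}\mathbb B_p^n$, where $\mathbb B_p^n=\{x\in\mathbb R^n:\sum_i|x_i|^p\le1\}$. Then $\{\|X^{(n,p)}\|_2/\sqrt n\}_{n\in\mathbb N}$ satisfies an LDP in $\mathbb R$ at speed $n$ with GRF $J_{X,p}$, where $$J_{X,2}(x)=\begin{cases}-\log x,&x\in(0,1],\\+\infty,&\text{otherwise},\end{cases}$$ and for $p>2$, $$J_{X,p}(x)=\begin{cases}\inf_{y\ge x}\left[\frac12\log\frac{y^2}{x^2}+F_p^*(y^2)\right],&x\in(0,1),\\+\infty,&\text{otherwise}.\end{cases}$$ Moreover, $J_{X,p}$ has a unique minimizer, at $m(p)$.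
   Context: For $p\ge1$, $f_p(x)=\frac1{2p^{1/p}\Gamma(1+1/p)}e^{-|x|^p/p}$, $x\in\mathbb R$; $$F_p^*(y)=\sup_{t_1,t_2\in\mathbb R}\left[t_1y+t_2-\log\int_{\mathbb R}e^{t_1x^2+t_2|x|^p}f_p(x)\,dx\right],\quad y\in\mathbb R;\qquad m(p)=\left(\frac{p^{2/p}\,\Gamma(1+3/p)}{3\,\Gamma(1+1/p)}\right)^{1/2}.$$ LDP: a sequence of random variables $\{\eta_n\}$ with values in a regular topological space $\mathcal X$ satisfies a large deviation principle (LDP) at speed $s_n$ (positive reals with $s_n\to\infty$) with rate function $I:\mathcal X\to[0,\infty]$ if $I$ is lower semicontinuous and for every Borel set $\Gamma$, $-\inf_{\Gamma^\circ}I\le\liminf_n\frac1{s_n}\log\mathbb P(\eta_n\in\Gamma)\le\limsup_n\frac1{s_n}\log\mathbb P(\eta_n\in\Gamma)\le-\inf_{\bar\Gamma}I$. It is a good rate function (GRF) if moreover its level sets are compact. *)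

(* Defs.v *)
From HB Require Import structures.
From mathcomp Require Import all_boot all_order all_algebra.
From mathcomp Require Import all_classical all_reals all_analysis.

Set Implicit Arguments.
Unset Strict Implicit.
Unset Printing Implicit Defensive.

Import Order.TTheory GRing.Theory Num.Theory.
Import numFieldNormedType.Exports.

Local Open Scope classical_set_scope.
Local Open Scope ring_scope.

Definition borel {E : topologicalType} : set (set E) := <<s @open E >>.

(* The random elements [eta n] may live on different probability spaces.
   With [lne 0 = -oo] and [ereal_inf set0 = +oo], null events and empty
   interiors follow the usual conventions. *)
Definition satisfies_ldp {R : realType} {E : topologicalType}
    {d : nat -> measure_display} {T : forall n, measurableType (d n)}
    (P : forall n, probability (T n) R) (eta : forall n, T n -> E)
    (s : nat -> R) (I : E -> \bar R) : Prop :=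
  let rate G n := ((s n)^-1%:E * lne (P n (eta n @^-1` G)))%E in
  [/\ regular_space E,
      (forall n, 0 < s n) /\ s n @[n --> \oo] --> +oo,
      (forall n G, borel G -> measurable (eta n @^-1` G)),
      (forall x, (0 <= I x)%E) /\ lower_semicontinuous I &
      forall G, borel G ->
        [/\ (- ereal_inf (I @` G°) <= limn_einf (rate G))%E,
            (limn_einf (rate G) <= limn_esup (rate G))%E &
            (limn_esup (rate G) <= - ereal_inf (I @` closure G))%E]].

Definition compact_level_sets {R : realType} {E : topologicalType}
    (I : E -> \bar R) : Prop :=
  forall a : R, compact [set x | (I x <= a%:E)%E].

Definition satisfies_ldp_grf {R : realType} {E : topologicalType}
    {d : nat -> measure_display} {T : forall n, measurableType (d n)}
    (P : forall n, probability (T n) R) (eta : forall n, T n -> E)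
    (s : nat -> R) (I : E -> \bar R) : Prop :=
  satisfies_ldp P eta s I /\ compact_level_sets I.

(* Lebesgue measure on R^n, as the iterated product measure: the measure of a
   measurable set is the integral of the measures of its sections. *)
Fixpoint lebesgue_volume {R : realType} (n : nat) :
    set (n.-tuple R) -> \bar R :=
  match n with
  | 0 => fun A => \d_([tuple] : 0.-tuple R) A
  | m.+1 => fun A =>
      (\int[@lebesgue_measure R]_x
         lebesgue_volume [set t : m.-tuple R | A [tuple of x :: t]])%E
  end.

Lemma lebesgue_volume0 (R : realType) (n : nat) :
  lebesgue_volume (set0 : set (n.-tuple R)) = 0%E.
Proof.
elim: n => [|n IH] /=; first by rewrite /dirac indic0.
by apply: integral0_eq => y _; exact: IH.
Qed.

Lemma lebesgue_volume_box (R : realType) (n : nat) (a b : 'I_n -> R) :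
  (forall i, a i <= b i) ->
  lebesgue_volume [set t : n.-tuple R | forall i, tnth t i \in `[a i, b i]] =
  (\prod_(i < n) (b i - a i))%:E.
Proof.
elim: n a b => [|n IH] a b ab.
  by rewrite big_ord0 /= /dirac indicE mem_set// => -[].
rewrite big_ord_recl /=.
set c := \prod_(i < n) _.
transitivity (\int[@lebesgue_measure R]_x
   (c%:E * (\1_(`[a ord0, b ord0]%classic : set R) x)%:E))%E.
  apply: eq_integral => x _.
  rewrite indicE; case: (boolP (x \in _)) => xab.
    rewrite mule1 /c -IH; last by move=> i; exact: ab.
    congr lebesgue_volume; apply/seteqP; split => t /= h i.
      by have := h (lift ord0 i); rewrite tnthS.
    case: (unliftP ord0 i) => [j|] ->; first by rewrite tnthS; exact: h.
    by rewrite tnth0; move/set_mem: xab.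
  rewrite mule0 (_ : [set _ | _] = set0) ?lebesgue_volume0//.
  apply/seteqP; split => t //= /(_ ord0); rewrite tnth0 => xx.
  by move: xab; rewrite mem_set.
rewrite ge0_integralZl//.
- rewrite integral_indic// setIT.
  rewrite [Measure.sort _ _]/= lebesgue_measure_itv /= lte_fin.
  case: ltP => [_|ba]; first by rewrite -EFinD -EFinM mulrC.
  have -> : b ord0 = a ord0 by apply/eqP; rewrite eq_le ba ab.
  by rewrite mule0 subrr mul0r.
- by apply/measurable_realfun.measurable_EFinP; exact: measurable_realfun.measurable_indic.
- by rewrite lee_fin prodr_ge0// => i _; rewrite subr_ge0.
Qed.

Definition uniform_on {R : realType} {d} {T : measurableType d}
    (P : probability T R) (n : nat) (K : set (n.-tuple R))
    (X : {RV P >-> n.-tuple R}) : Prop :=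
  forall A : set (n.-tuple R), measurable A ->
    distribution P X A = (lebesgue_volume (A `&` K) / lebesgue_volume K)%E.

Definition lp_ball {R : realType} (p : R) (n : nat) : set (n.-tuple R) :=
  [set x | \sum_(i < n) `|tnth x i| `^ p <= 1].

Definition dilate {R : realType} (n : nat) (c : R) (K : set (n.-tuple R)) :
    set (n.-tuple R) :=
  (fun x : n.-tuple R => [tuple c * tnth x i | i < n]) @` K.

Definition l2norm {R : realType} (n : nat) (x : n.-tuple R) : R :=
  Num.sqrt (\sum_(i < n) tnth x i ^+ 2).

Definition Gamma {R : realType} (s : R) : R :=
  \int[@lebesgue_measure R]_(t in `]0, +oo[) (t `^ (s - 1) * expR (- t)).

Definition gen_gaussian_pdf {R : realType} (p x : R) : R :=
  (2 * p `^ p^-1 * Gamma (1 + p^-1))^-1 * expR (- (`|x| `^ p / p)).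

(* Equal to +oo when the integral diverges; the pair (t1, t2) then contributes
   -oo to the supremum defining [Fstar]. *)
Definition log_mgf {R : realType} (p t1 t2 : R) : \bar R :=
  lne (\int[@lebesgue_measure R]_x
         (expR (t1 * x ^+ 2 + t2 * `|x| `^ p) * gen_gaussian_pdf p x)%:E)%E.

Definition Fstar {R : realType} (p y : R) : \bar R :=
  ereal_sup [set ((t1 * y + t2)%:E - log_mgf p t1 t2)%E
            | t1 in [set: R] & t2 in [set: R]].

Definition JX {R : realType} (p x : R) : \bar R :=
  if p == 2 then
    if 0 < x <= 1 then (- ln x)%:E else +oo%E
  else
    if 0 < x < 1 then
      ereal_inf [set ((2^-1 * ln (y ^+ 2 / x ^+ 2))%:E + Fstar p (y ^+ 2))%E
                | y in [set y : R | x <= y]]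
    else +oo%E.

Definition mp {R : realType} (p : R) : R :=
  Num.sqrt (p `^ (2 / p) * Gamma (1 + 3 / p) / (3 * Gamma (1 + p^-1))).

(* Main.v *)
(** Write S and N for the averages of x_i^2 and |x_i|^p over i < n, so that the
    uniform law on the dilated ball is Lebesgue measure restricted to N <= 1, and
    let Z(t,s) be the integral of w_{t,s}(u) = exp (t u^2 - s |u|^p).  For s >= 0
    the indicator of {N <= 1, S near y} is at most a product of one-variable
    functions of integral exp (n (s - t y + ln Z(t,s))), which with a finite cover
    of [0,2] gives the upper bound.  For the lower bound at y < 1 one shrinks the
    target to (Y, r) = (l^2 y, l^p) with l < 1 and minimises
    Z(t,s) exp (s r - t Y) over s >= eps: at the minimiser the tilted density
    proportional to w_{t,s} has E u^2 = Y and E |u|^p <= r < 1, so Chernoff bounds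
    show that most of the tilted mass lies in {N <= 1, S near y}.
    Both bounds agree because sup_{t, s >= 0} of
    t y - s + 1/p + ln Z(0,1/p) - ln Z(t,s) is the rate at sqrt y: the infimum
    over y >= x defining J_{X,p} is attained at y = x, by the scaling
    Z(t,s) = c Z(t c^2, s c^p).
    Volumes are iterated integrals whose inner functions
    need not be known to be measurable; only integrals of products of
    one-variable functions are ever compared with them. *)
Require Import Defs.
From mathcomp Require Import finmap.
From mathcomp Require Import all_boot all_order all_algebra.
From mathcomp Require Import all_classical all_reals all_analysis.
From mathcomp Require Import measurable_realfun ring lra.
Import Order.TTheory GRing.Theory Num.Theory.
Import numFieldNormedType.Exports.
Set Implicit Arguments.
Unset Strict Implicit.
Unset Printing Implicit Defensive.
Local Open Scope classical_set_scope.
Local Open Scope ring_scope.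

(** Contracting the target by l makes its constraints strict: r < 1 leaves Chernoff room inside {N
    <= 1}, and Y < l^2 makes the minimised function grow in every direction of (t, s). The barrier s
    >= eps keeps the minimiser where small perturbations of (t, s) remain integrable; E |u|^p may
    then stay below r, but only if s = eps, and the mismatch costs at most eps r in the exponent.
    The lower bound produces just some Legendre term at y, which weak duality bounds by the rate, so
    the optimal pair (t, s) is never identified. For p = 2 one has N = S and only s - t matters; a
    Gaussian of variance Y is then an explicit tilt, which also covers y = 1. Since the upper bound
    covers all of [0,2], duality is also established where the rate is infinite, by explicit
    families of (t, s) with unbounded terms. The volume of the ball, the denominator of every
    probability, is bounded below by the shell around the minimiser, where the rate is 0. Minimality
    becomes moment identities through a quadratic bound on exp instead of derivatives of Z. *)

(** * Real integrals, and comparison with functions not known to be measurable *)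

Definition integrableR (R : realType) (f : R -> R) : Prop :=
  lebesgue_measure.-integrable setT (EFin \o f).

Definition intR (R : realType) (f : R -> R) : R :=
  \int[@lebesgue_measure R]_x f x.

Section IntegrableR.
Context {R : realType}.
Implicit Types (f g : R -> R) (c : R).

Lemma intRE f : integrableR f ->
  (\int[@lebesgue_measure R]_x (f x)%:E)%E = (intR f)%:E.
Proof. by move=> fi; rewrite /intR /Rintegral fineK//; exact: integrable_fin_num. Qed.

Lemma eq_intR f g : f =1 g -> intR f = intR g.
Proof. by move=> fg; congr intR; apply/funext. Qed.

Lemma integrableRZ c f : integrableR f -> integrableR (fun x => c * f x).
Proof. by move=> fi; exact: (integrableZl measurableT c fi). Qed.

Lemma integrableRD f g : integrableR f -> integrableR g ->
  integrableR (fun x => f x + g x).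
Proof. by move=> fi gi; exact: (integrableD measurableT fi gi). Qed.

Lemma intRZ c f : integrableR f -> intR (fun x => c * f x) = c * intR f.
Proof. by move=> fi; exact: RintegralZl. Qed.

Lemma intRD f g : integrableR f -> integrableR g ->
  intR (fun x => f x + g x) = intR f + intR g.
Proof. by move=> fi gi; exact: RintegralD. Qed.

Lemma integrableR_measurable f : integrableR f -> measurable_fun setT f.
Proof. by move=> /integrableP[/measurable_EFinP]. Qed.

Lemma le_intR f g : integrableR f -> integrableR g ->
  (forall x, f x <= g x) -> intR f <= intR g.
Proof. by move=> fi gi fg; apply: le_Rintegral => // x _. Qed.

Lemma intR_ge0 f : (forall x, 0 <= f x) -> 0 <= intR f.
Proof. by move=> f0; apply: Rintegral_ge0 => x _. Qed.

Lemma le_integrableR f g : measurable_fun setT f ->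
  (forall x, `|f x| <= g x) -> integrableR g -> integrableR f.
Proof.
move=> mf fg gi; apply: (le_integrable measurableT _ _ gi).
  exact/measurable_EFinP.
by move=> x _; rewrite /= lee_fin (le_trans (fg x))// ler_norm.
Qed.

Lemma integrableR_sum (J : Type) (r : seq J) (c : J -> R) (f : J -> R -> R) :
  (forall j, integrableR (f j)) ->
  integrableR (fun x => \sum_(j <- r) c j * f j x).
Proof.
move=> fi; elim: r => [|j r IH].
  under eq_fun do rewrite big_nil.
  exact: integrable0.
by under eq_fun do rewrite big_cons; apply: integrableRD => //; exact: integrableRZ.
Qed.

Lemma intR_sum (J : Type) (r : seq J) (c : J -> R) (f : J -> R -> R) :
  (forall j, integrableR (f j)) ->
  intR (fun x => \sum_(j <- r) c j * f j x) = \sum_(j <- r) c j * intR (f j).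
Proof.
move=> fi; elim: r => [|j r IH].
  rewrite big_nil; under eq_intR do rewrite big_nil.
  by rewrite /intR /Rintegral integral0.
rewrite big_cons -IH -intRZ// -intRD; [|exact: integrableRZ|exact: integrableR_sum].
by apply: eq_intR => x; rewrite big_cons.
Qed.

(* The section functions in the definition of [lebesgue_volume] need not be
   known to be measurable, hence the absence of measurability of [g]. *)
Lemma le_integral_ge0 f (g : R -> \bar R) :
  (forall x, 0 <= g x)%E -> integrableR f -> (forall x, (f x)%:E <= g x)%E ->
  ((intR f)%:E <= \int[@lebesgue_measure R]_x g x)%E.
Proof.
move=> g0 fi fg; rewrite -intRE// integralE [leRHS]integralE.
have -> : (\int[@lebesgue_measure R]_x g^\- x = 0)%E.
  by apply: integral0_eq => x _; rewrite funenegE max_r// leeNl oppe0 g0.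
rewrite sube0; apply: (@le_trans _ _ (\int[@lebesgue_measure R]_x (EFin \o f)^\+ x)%E).
  have fin := integrable_neg_fin_num measurableT fi.
  by rewrite leeBlDr// leeDl// integral_ge0.
rewrite !ge0_integralTE//.
apply: ereal_sup_le => _ [h hf <-]; exists h => // x.
apply: (le_trans (hf x)).
by rewrite !funeposE ge_max !le_max fg lexx orbT.
Qed.

(** The integral of a nonnegative function is a supremum over the simple functions below it, and a
    larger function has more of them; measurability does not enter. *)
Lemma ge0_le_integral_nonmeasurable (g1 g2 : R -> \bar R) :
  (forall x, 0 <= g1 x)%E -> (forall x, g1 x <= g2 x)%E ->
  (\int[@lebesgue_measure R]_x g1 x <= \int[@lebesgue_measure R]_x g2 x)%E.
Proof.
move=> g0 g12; have g20 x : (0 <= g2 x)%E by exact: le_trans (g0 x) (g12 x).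
rewrite !ge0_integralTE//; apply: ereal_sup_le => _ [h hf <-].
by exists h => // x; apply: (le_trans (hf x)).
Qed.

Lemma ge0_integral_le f (g : R -> \bar R) :
  (forall x, 0 <= g x)%E -> integrableR f -> (forall x, g x <= (f x)%:E)%E ->
  (\int[@lebesgue_measure R]_x g x <= (intR f)%:E)%E.
Proof.
by move=> g0 fi fg; rewrite -intRE//; exact: ge0_le_integral_nonmeasurable.
Qed.

End IntegrableR.

(** * Volumes compared with sums of products of one-variable functions *)

Lemma lebesgue_volume_ge0 {R : realType} n (A : set (n.-tuple R)) :
  (0 <= lebesgue_volume A)%E.
Proof.
elim: n A => [|n IH] A /=; first by rewrite /dirac indicE lee_fin.
by apply: integral_ge0 => x _; exact: IH.
Qed.

Lemma subset_lebesgue_volume {R : realType} n (A B : set (n.-tuple R)) :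
  A `<=` B -> (lebesgue_volume A <= lebesgue_volume B)%E.
Proof.
elim: n A B => [|n IH] A B AB /=.
  rewrite /dirac lee_fin !indicE; case: (boolP (_ \in A)) => [|_]; last by rewrite ler0n.
  by rewrite inE => /AB AB'; rewrite mem_set.
apply: ge0_le_integral_nonmeasurable => x; first exact: lebesgue_volume_ge0.
by apply: IH => t; exact: AB.
Qed.

Section VolumeBounds.
Context {R : realType} {J : Type}.
Implicit Types (r : seq J) (c : J -> R) (f : J -> R -> R).

Let prod_cons n (g : R -> R) x (t : n.-tuple R) :
  \prod_(i < n.+1) g (tnth [tuple of x :: t] i) = g x * \prod_(i < n) g (tnth t i).
Proof.
rewrite big_ord_recl tnth0; congr (_ * _).
by apply: eq_bigr => i _; rewrite tnthS.
Qed.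

Let indic_cons n (A : set (n.+1.-tuple R)) x (t : n.-tuple R) :
  \1_A [tuple of x :: t] = \1_[set u : n.-tuple R | A [tuple of x :: u]] t :> R.
Proof. by rewrite !indicE; congr (_%:R); congr nat_of_bool; apply/idP/idP; rewrite !inE. Qed.

(** Induction on the dimension: fixing the first coordinate x replaces [c j] by [c j * f j x], so
    the coefficients have to be arbitrary reals. Negative ones serve later to subtract Chernoff
    bounds from the tilted mass. *)
Lemma lebesgue_volume_ge n r c f (A : set (n.-tuple R)) :
  (forall j, integrableR (f j)) ->
  (forall x : n.-tuple R,
     \sum_(j <- r) c j * \prod_(i < n) f j (tnth x i) <= \1_A x) ->
  ((\sum_(j <- r) c j * intR (f j) ^+ n)%:E <= lebesgue_volume A)%E.
Proof.
move=> fi; elim: n c A => [|n IH] c A fA /=.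
  rewrite /dirac lee_fin; apply: le_trans (fA [tuple]).
  by apply: ler_sum => j _; rewrite big_ord0 expr0.
under eq_bigr do rewrite exprSr mulrA.
rewrite -intR_sum//; apply: le_integral_ge0.
- by move=> x; exact: lebesgue_volume_ge0.
- exact: integrableR_sum.
move=> x; under eq_bigr do rewrite mulrAC.
apply: IH => t; rewrite -indic_cons; apply: le_trans (fA _).
by apply: ler_sum => j _; rewrite prod_cons mulrA.
Qed.

Lemma lebesgue_volume_le n r c f (A : set (n.-tuple R)) :
  (forall j, integrableR (f j)) ->
  (forall x : n.-tuple R,
     \1_A x <= \sum_(j <- r) c j * \prod_(i < n) f j (tnth x i)) ->
  (lebesgue_volume A <= (\sum_(j <- r) c j * intR (f j) ^+ n)%:E)%E.
Proof.
move=> fi; elim: n c A => [|n IH] c A fA /=.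
  rewrite /dirac lee_fin; apply: (le_trans (fA [tuple])).
  by apply: ler_sum => j _; rewrite big_ord0 expr0.
under eq_bigr do rewrite exprSr mulrA.
rewrite -intR_sum//; apply: ge0_integral_le.
- by move=> x; exact: lebesgue_volume_ge0.
- exact: integrableR_sum.
move=> x; under eq_bigr do rewrite mulrAC.
apply: IH => t; rewrite -indic_cons; apply: (le_trans (fA _)).
by apply: ler_sum => j _; rewrite prod_cons mulrA.
Qed.

End VolumeBounds.

(** * Elementary inequalities for exp and ln *)

Section ExponentialBounds.
Context {R : realType}.
Implicit Types x y : R.

Lemma expR_sub1_le x : expR x - 1 <= x * expR x.
Proof.
have := expR_ge1Dx (- x); have := expR_gt0 x; have := expRxMexpNx_1 x.
by move: (expR x) (expR (- x)) => a b ab a0 b1; nra.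
Qed.

Lemma norm_expR_sub1_le x : `|expR x - 1| <= `|x| * expR `|x|.
Proof.
have h1 := expR_sub1_le x; have h2 := expR_ge1Dx x.
have h3 : expR x <= expR `|x| by rewrite ler_expR ler_norm.
have h4 : 1 <= expR `|x| by rewrite (le_trans _ (expR_ge1Dx _))// lerDl.
have h5 := expR_gt0 x; have h6 := ler_norm x; have h7 := normr_ge0 x.
have h8 : - x <= `|x| by rewrite -normrN ler_norm.
by rewrite ler_norml; apply/andP; split; nra.
Qed.

(** From exp x - 1 - x <= x (exp x - 1): the last factor is at most x exp x when x >= 0 and at least
    x when x < 0. *)
Lemma expR_quadratic_le x : expR x <= 1 + x + x ^+ 2 * expR `|x|.
Proof.
have h1 := expR_sub1_le x; have h2 := expR_ge1Dx x.
have h3 : expR x <= expR `|x| by rewrite ler_expR ler_norm.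
have h4 : 1 <= expR `|x| by rewrite (le_trans _ (expR_ge1Dx _))// lerDl.
by have [x0|x0] := leP 0 x; nra.
Qed.

Lemma sqr_le_expR x : 0 <= x -> x ^+ 2 <= 4 * expR x.
Proof.
move=> x0; have := expR_ge1Dx (x / 2).
have -> : expR x = expR (x / 2) ^+ 2 by rewrite -expRM_natl; congr expR; field.
by move: (expR _) => e he; nra.
Qed.

Lemma add_ln_le (m A B : R) : 0 < A -> 0 < B -> expR m * A <= B ->
  m + ln A <= ln B.
Proof. by move=> A0 B0 H; rewrite -ler_expR expRD !lnK ?posrE. Qed.

Lemma ln_le_add (m A B : R) : 0 < A -> 0 < B -> B <= A * expR m ->
  ln B <= ln A + m.
Proof. by move=> A0 B0 H; rewrite -ler_expR expRD !lnK ?posrE. Qed.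

(** First-order condition with a quadratic error: a negative slope [a] would win as soon as h (|C| +
    1) <= - a / 2. *)
Lemma ge0_slope (a C delta : R) : 0 < delta ->
  (forall h, 0 < h -> h <= delta -> 0 <= h * a + C * h ^+ 2) -> 0 <= a.
Proof.
move=> d0 H; rewrite leNgt; apply/negP => a0.
have C1 : 0 < `|C| + 1 by rewrite ltr_wpDl.
pose h := Num.min delta (- a / (2 * (`|C| + 1))).
have h0 : 0 < h by rewrite lt_min d0 divr_gt0//; lra.
have := H h h0; rewrite ge_min lexx => /(_ isT).
have hC : h * (2 * (`|C| + 1)) <= - a.
  by rewrite -ler_pdivlMr ?ge_min ?lexx ?orbT//; lra.
have := ler_norm C; nra.
Qed.

End ExponentialBounds.

(** * Integrals of exp (h xi) w for small h *)

Section MomentGeneratingFunction.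
Context {R : realType}.
Variables (w xi : R -> R) (eta : R).
Hypotheses (eta0 : 0 < eta) (w0 : forall x, 0 <= w x).
Hypotheses (mw : measurable_fun setT w) (mxi : measurable_fun setT xi).
Hypothesis exp_w : integrableR (fun x => expR (eta * `|xi x|) * w x).

Lemma integrableR_weight : integrableR w.
Proof.
apply: le_integrableR exp_w => // x.
by rewrite ger0_norm// ler_peMl// (le_trans _ (expR_ge1Dx _))// lerDl mulr_ge0// ltW.
Qed.

Lemma integrableR_exp_weight h : `|h| <= eta ->
  integrableR (fun x => expR (h * xi x) * w x).
Proof.
move=> he; apply: le_integrableR exp_w => [|x].
  apply: measurable_funM => //; apply: measurableT_comp => //.
  exact: measurable_funM.
rewrite normrM (ger0_norm (expR_ge0 _)) (ger0_norm (w0 x)) ler_wpM2r// ler_expR.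
by rewrite (le_trans (ler_norm _))// normrM ler_wpM2r.
Qed.

Let measurable_exp_norm h : measurable_fun setT (fun x => expR (h * `|xi x|)).
Proof.
apply: measurableT_comp => //; apply: measurable_funM => //.
exact: measurableT_comp.
Qed.

(** Half of the available exponent pays for the square, by z^2 <= 4 exp z at z = eta |xi| / 2. *)
Lemma integrableR_sqr_weight :
  integrableR (fun x => xi x ^+ 2 * expR (eta / 2 * `|xi x|) * w x).
Proof.
apply: (le_integrableR _ _ (integrableRZ (16 / eta ^+ 2) exp_w)) => [|x].
  apply: measurable_funM => //; apply: measurable_funM => //.
  exact: measurable_funX.
have hx : 0 <= xi x ^+ 2 * expR (eta / 2 * `|xi x|) * w x.
  by apply: mulr_ge0 => //; apply: mulr_ge0; rewrite ?sqr_ge0 ?expR_ge0.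
rewrite (ger0_norm hx) [leRHS]mulrA ler_wpM2r//.
have -> : expR (eta * `|xi x|) = expR (eta / 2 * `|xi x|) * expR (eta / 2 * `|xi x|).
  by rewrite -expRD; congr expR; field.
rewrite mulrA ler_wpM2r ?expR_ge0//.
have := @sqr_le_expR R (eta / 2 * `|xi x|).
have -> : 0 <= eta / 2 * `|xi x| by rewrite mulr_ge0// divr_ge0// ltW.
move=> /(_ isT); rewrite exprMn real_normK ?num_real//.
have e2 : 0 < eta ^+ 2 / 4 by rewrite divr_gt0// exprn_gt0.
have -> : 16 / eta ^+ 2 = 4 / (eta ^+ 2 / 4).
  by field; rewrite gt_eqF.
rewrite [4 / _ * _]mulrAC ler_pdivlMr//.
by apply: le_trans; rewrite le_eqVlt; apply/orP; left; apply/eqP; field.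
Qed.

Lemma integrableR_mul_weight : integrableR (fun x => xi x * w x).
Proof.
apply: (le_integrableR _ _ (integrableRD integrableR_weight integrableR_sqr_weight)) => [|x].
  exact: measurable_funM.
rewrite normrM (ger0_norm (w0 x)) -[X in _ <= X + _]mul1r -mulrDl ler_wpM2r//.
have : 1 <= expR (eta / 2 * `|xi x|).
  by rewrite (le_trans _ (expR_ge1Dx _))// lerDl mulr_ge0// divr_ge0// ltW.
rewrite -[xi x ^+ 2]real_normK ?num_real//.
have := normr_ge0 (xi x); move: `|xi x| (expR _) => a b a0 b1.
have : a ^+ 2 <= a ^+ 2 * b by rewrite ler_peMr ?sqr_ge0.
have := sqr_ge0 (a - 1); nra.
Qed.

(** Integrated form of [expR_quadratic_le]. Restricting h to eta / 2 lets one constant serve for all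
    h: the integral of xi^2 exp (eta |xi| / 2) w. *)
Lemma mgf_quadratic_le : exists2 C, 0 <= C & forall h, `|h| <= eta / 2 ->
  intR (fun x => expR (h * xi x) * w x) <=
  intR w + h * intR (fun x => xi x * w x) + C * h ^+ 2.
Proof.
have iw := integrableR_weight; have ixw := integrableR_mul_weight.
have isw := integrableR_sqr_weight.
exists (intR (fun x => xi x ^+ 2 * expR (eta / 2 * `|xi x|) * w x)).
  by apply: intR_ge0 => x; apply: mulr_ge0 => //; apply: mulr_ge0; rewrite ?sqr_ge0 ?expR_ge0.
move=> h he; have i1 := integrableRZ h ixw; have i2 := integrableRZ (h ^+ 2) isw.
have i12 := integrableRD iw i1.
rewrite [_ * h ^+ 2]mulrC -(intRZ _ ixw) -(intRZ _ isw) -intRD// -intRD//.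
apply: le_intR; last 1 first.
- move=> x.
  have -> : w x + h * (xi x * w x) +
      h ^+ 2 * (xi x ^+ 2 * expR (eta / 2 * `|xi x|) * w x) =
      (1 + h * xi x + (h * xi x) ^+ 2 * expR (eta / 2 * `|xi x|)) * w x by ring.
  rewrite ler_wpM2r// (le_trans (expR_quadratic_le _))// lerD2l ler_wpM2l ?sqr_ge0//.
  by rewrite ler_expR normrM ler_wpM2r.
- apply: integrableR_exp_weight; apply: (le_trans he).
  by rewrite ler_pdivrMr// ler_peMr ?ler1n// ltW.
- exact: integrableRD.
Qed.

Lemma intR_mul_weight_ge0 delta : 0 < delta ->
  (forall h, 0 < h -> h <= delta ->
     intR w <= intR (fun x => expR (h * xi x) * w x)) ->
  0 <= intR (fun x => xi x * w x).
Proof.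
move=> d0 H; have [C C0 HC] := mgf_quadratic_le.
apply: (@ge0_slope R _ C (Num.min delta (eta / 2))) => [|h h0].
  by rewrite lt_min d0 divr_gt0.
rewrite le_min => /andP[hd he].
have := le_trans (H h h0 hd) (HC h _); rewrite gtr0_norm// => /(_ he).
lra.
Qed.

(** Chernoff's argument: with mean zero the integral grows only to Z + C h^2, while the shift by d
    gains a factor 1 + h d, which wins for small h. *)
Lemma mgf_centered_lt d : 0 < intR w ->
  intR (fun x => xi x * w x) = 0 -> 0 < d ->
  exists h, [/\ 0 < h, h <= eta &
    intR (fun x => expR (h * (xi x - d)) * w x) < intR w].
Proof.
move=> Z0 m0 d0; have [C C0 HC] := mgf_quadratic_le.
set Z := intR w in Z0 HC *.
pose h := Num.min (eta / 2) (Num.min d^-1 (Z * d / (4 * (C + 1)))).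
have h0 : 0 < h.
  by rewrite !lt_min divr_gt0//= invr_gt0 d0 divr_gt0 ?mulr_gt0//; lra.
have he : h <= eta / 2 by rewrite ge_min lexx.
exists h; split => //; first by lra.
have -> : intR (fun x => expR (h * (xi x - d)) * w x) =
          expR (- (h * d)) * intR (fun x => expR (h * xi x) * w x).
  rewrite -intRZ; last by apply: integrableR_exp_weight; rewrite gtr0_norm//; lra.
  by apply: eq_intR => x; rewrite mulrA -expRD; congr (expR _ * _); ring.
have := HC h; rewrite gtr0_norm// => /(_ he); rewrite m0 mulr0 addr0 => H.
apply: (@le_lt_trans _ _ (expR (- (h * d)) * (Z + C * h ^+ 2))).
  by rewrite ler_wpM2l ?expR_ge0.
rewrite expRN mulrC ltr_pdivrMr ?expR_gt0//.
apply: (@lt_le_trans _ _ (Z * (1 + h * d))); last by rewrite ler_wpM2l ?expR_ge1Dx// ltW.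
have hC : h * (4 * (C + 1)) <= Z * d.
  by rewrite -ler_pdivlMr ?ge_min ?lexx ?orbT//; lra.
have Zd : 0 < Z * d by exact: mulr_gt0.
nra.
Qed.

End MomentGeneratingFunction.

(** * Change of scale, continuity of powers, and bounds on intervals *)

Section Scaling.
Context {R : realType}.
Variables (f : R -> R) (c : R).
Hypotheses (c0 : 0 < c) (cf : continuous f) (f0 : forall x, 0 <= f x).

Let integral_scale :
  (\int[@lebesgue_measure R]_x (f x)%:E =
   \int[@lebesgue_measure R]_x (f (c * x) * c)%:E)%E.
Proof.
have dF (x : R) : is_derive x (1 : R) ( *%R c) c.
  have := is_deriveZ (f := id) c (is_derive_id x 1).
  by rewrite /GRing.scale/= mulr1.
have F' : ( *%R c : R -> R)^`()%classic = cst c.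
  by apply/funext => x; rewrite derive1E; apply: derive_val.
rewrite (@increasing_ge0_integration_by_substitutionT R ( *%R c) f)//.
- by apply: eq_integral => x _; rewrite fctE F'.
- by move=> x y xy; rewrite ltr_pM2l.
- by rewrite F' => x; exact: cvg_cst.
- by rewrite F'; exact: is_cvg_cst.
- by rewrite F'; exact: is_cvg_cst.
- by apply: gt0_cvgMrNy => //; exact: cvg_id.
- by apply: gt0_cvgMry => //; exact: cvg_id.
Qed.

Lemma integrableR_scale : integrableR f -> integrableR (fun x => f (c * x)).
Proof.
move=> fi.
have -> : (fun x => f (c * x)) = (fun x => c^-1 * (f (c * x) * c)).
  by apply/funext => x; rewrite [RHS]mulrC mulfK// gt_eqF.
apply: integrableRZ; apply/integrableP; split.
  apply/measurable_EFinP; apply: measurable_funM => //.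
  apply: continuous_measurable_fun => x; apply: continuous_comp; last exact: cf.
  exact: mulrl_continuous.
have -> : (fun x => `|(EFin \o (fun y => (f (c * y) * c)%R)) x|%E) =
          (fun x => (f (c * x) * c)%:E).
  by apply/funext => x /=; rewrite ger0_norm// mulr_ge0// ltW.
by rewrite -integral_scale intRE// ltry.
Qed.

Lemma intR_scale : integrableR f -> intR (fun x => f (c * x)) = c^-1 * intR f.
Proof.
move=> fi; have fci := integrableR_scale fi.
rewrite [intR f]/intR /Rintegral integral_scale.
under eq_integral do rewrite mulrC.
by rewrite -[fine _]/(intR (fun x => c * f (c * x))) intRZ// mulKf// gt_eqF.
Qed.

End Scaling.

Lemma continuous_norm_powR {R : realType} (p : R) : 0 < p ->
  continuous (fun x : R => `|x| `^ p).
Proof.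
move=> p0.
(* At 0 the explicit radius e^(1/p) works; elsewhere |x| is positive and the power is
   differentiable. *)
have cvg0 : `|y| `^ p @[y --> (0 : R)] --> (0 : R).
  apply/cvgr0Pnorm_le => e e0.
  have d0 : 0 < e `^ p^-1 by rewrite powR_gt0.
  near=> y.
  have yd : `|y| <= e `^ p^-1.
    by near: y; exists (e `^ p^-1) => //= z /=; rewrite sub0r normrN; exact: ltW.
  rewrite ger0_norm ?powR_ge0//.
  have -> : e = (e `^ p^-1) `^ p by rewrite -powRrM mulVf ?gt_eqF// powRr1// ltW.
  by rewrite ge0_ler_powR ?nnegrE ?(ltW p0) ?(ltW d0).
move=> x; have [->|x0] := eqVneq x 0.
  by rewrite /continuous_at normr0 powR0 ?gt_eqF.
apply: (@continuous_comp _ _ _ (fun y : R => `|y|) (fun y => y `^ p)).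
  exact: norm_continuous.
apply/differentiable_continuous/derivable1_diffP.
by apply: derivable_powR; rewrite in_itv/= andbT normr_gt0.
Unshelve. all: by end_near. Qed.

Section IntervalBounds.
Context {R : realType}.
Variable f : R -> R.
Hypotheses (fi : integrableR f) (f0 : forall x, 0 <= f x).

Lemma intR_ge_itv (a b c : R) : a <= b ->
  (forall x, a <= x <= b -> c <= f x) -> c * (b - a) <= intR f.
Proof.
move=> ab cf.
have mab : measurable (`[a, b]%classic : set R) by exact: measurable_itv.
have ii : integrableR (\1_(`[a, b]%classic : set R) : R -> R).
  exact: (integrable_indic_itv a b true false).
have E : intR (\1_(`[a, b]%classic : set R) : R -> R) = b - a.
  rewrite /intR /Rintegral integral_indic// setIT [Measure.sort _ _]/= lebesgue_measure_itv /= lte_fin.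
  case: ltP => [_|ba]; first by rewrite -EFinD.
  by have -> : b = a; [apply/eqP; rewrite eq_le ba ab|rewrite subrr].
rewrite -E -intRZ//; apply: le_intR => //; first exact: integrableRZ.
move=> x; rewrite indicE; case: (boolP (x \in _)) => [|_]; last by rewrite mulr0.
by rewrite inE /= in_itv/= mulr1 => /cf.
Qed.

Lemma integrableR_not_ge1 (a : R) : ~ (forall x, a <= x -> 1 <= f x).
Proof.
move=> H.
have b0 : 0 <= intR f + 1 by rewrite addr_ge0// intR_ge0.
have := @intR_ge_itv a (a + (intR f + 1)) 1.
rewrite lerDl => /(_ b0); rewrite mul1r addrAC subrr add0r => K.
suff : intR f + 1 <= intR f by lra.
by apply: K => x /andP[ax _]; exact: H.
Qed.

End IntervalBounds.

(** * The weights and their integrals *)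

Definition gexp {R : realType} (p t s x : R) : R :=
  expR (t * x ^+ 2 - s * `|x| `^ p).

(** An open region of integrability. At p = 2 the weight is exp (- (s - t) x^2); for p > 2 the power
    wins for any t once s > 0. The integrable boundary s = 0, t < 0 is left out for p > 2, because
    perturbing s there can destroy integrability. *)
Definition admissible {R : realType} (p t s : R) : bool :=
  if p == 2 then t < s else 0 < s.

Section Weights.
Context {R : realType}.
Variable p : R.
Hypothesis p2 : 2 <= p.
Implicit Types t s x : R.
Let p0 : 0 < p. Proof. exact: lt_le_trans p2. Qed.
Let p1 : 1 <= p. Proof. by apply: le_trans p2; rewrite ler1n. Qed.

Lemma sqr_le_1D_powR x : x ^+ 2 <= 1 + `|x| `^ p.
Proof.
rewrite -real_normK ?num_real//; have [x1|x1] := leP `|x| 1.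
  by rewrite (le_trans (exprn_ile1 2 (normr_ge0 x) x1))// lerDl powR_ge0.
rewrite -powR_mulrn// (le_trans (ler_powR (ltW x1) p2))//.
by rewrite lerDr.
Qed.

Lemma continuous_gexp t s : continuous (gexp p t s).
Proof.
move=> x; apply: continuous_comp; last exact: continuous_expR.
apply: cvgB; (apply: cvgM; first exact: cvg_cst).
  by apply: exprn_continuous.
by apply: continuous_norm_powR.
Qed.

Lemma measurable_gexp t s : measurable_fun setT (gexp p t s).
Proof. by apply: continuous_measurable_fun; exact: continuous_gexp. Qed.

Lemma gexp_ge0 t s x : 0 <= gexp p t s x. Proof. exact: expR_ge0. Qed.

Lemma gexp_gaussian_le t s : admissible p t s -> exists C delta,
  0 < delta /\ forall x, t * x ^+ 2 - s * `|x| `^ p <= C - delta * x ^+ 2.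
Proof.
rewrite /admissible; case: ifPn => [/eqP -> ts|pN2 s0].
  exists 0, (s - t); split => [|x]; first by lra.
  by rewrite powR_mulrn// real_normK ?num_real//; lra.
have p2' : 0 < p - 2 by rewrite subr_gt0 lt_neqAle eq_sym pN2.
have a0 : 0 < (`|t| + 1) / s by rewrite divr_gt0// ltr_wpDl.
(* V solves s V^(p-2) = |t| + 1: above V the power dominates (|t| + 1) x^2, below V a constant
   does. *)
pose V := ((`|t| + 1) / s) `^ (p - 2)^-1.
exists ((`|t| + 1) * V ^+ 2), 1; split => // x.
suff : (`|t| + 1) * x ^+ 2 <= (`|t| + 1) * V ^+ 2 + s * `|x| `^ p.
  by have := ler_norm t; have := sqr_ge0 x; nra.
have V0 : 0 < V by rewrite powR_gt0.
have t1 : 0 <= `|t| + 1 by rewrite addr_ge0.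
have sx : 0 <= s * `|x| `^ p by rewrite mulr_ge0 ?powR_ge0// ltW.
rewrite -real_normK ?num_real//; have [xV|Vx] := leP `|x| V.
  by rewrite -[leLHS]addr0 lerD// ler_wpM2l// lerXn2r// nnegrE ltW.
rewrite -[leLHS]add0r; apply: lerD; first by rewrite mulr_ge0// sqr_ge0.
have x0 : 0 < `|x| by exact: lt_trans Vx.
have -> : `|x| `^ p = `|x| `^ (p - 2) * `|x| ^+ 2.
  by rewrite -powR_mulrn// -powRD ?subrK// gt_eqF// implybT.
rewrite mulrA ler_wpM2r ?sqr_ge0// mulrC -ler_pdivrMr//.
have -> : (`|t| + 1) / s = V `^ (p - 2).
  by rewrite -powRrM mulVf ?gt_eqF// powRr1 ?ltW.
by rewrite ge0_ler_powR ?nnegrE ?ltW.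
Qed.

Lemma integrableR_gexp t s : admissible p t s -> integrableR (gexp p t s).
Proof.
move=> /gexp_gaussian_le[C [delta [d0 H]]].
have sd : 0 < Num.sqrt delta by rewrite sqrtr_gt0.
have ig : integrableR (fun x => gauss_fun (Num.sqrt delta * x)).
  apply: (integrableR_scale sd); first exact: continuous_gauss_fun.
    exact: gauss_fun_ge0.
  exact: integrableT_gauss.
apply: (le_integrableR _ _ (integrableRZ (expR C) ig)) => [|x].
  exact: measurable_gexp.
rewrite ger0_norm ?gexp_ge0// /gauss_fun -expRD ler_expR.
by rewrite exprMn sqr_sqrtr ?H// ltW.
Qed.

Lemma admissible_open t s : admissible p t s ->
  exists2 eta, 0 < eta & forall e, e <= eta -> admissible p (t + e) (s - e).
Proof.
rewrite /admissible; case: ifP => _ ts.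
  by exists ((s - t) / 4) => [|e he]; lra.
by exists (s / 2) => [|e he]; lra.
Qed.

(** The span of x^2, |x|^p and 1 contains every statistic needed: centred deviations, and the
    exponents by which two weights differ. One integrability result then serves all. *)
Definition qpoly (a b c x : R) := a * x ^+ 2 + b * `|x| `^ p + c.

Lemma measurable_qpoly a b c : measurable_fun setT (qpoly a b c).
Proof.
apply: continuous_measurable_fun => x; apply: cvgD; last exact: cvg_cst.
apply: cvgD; (apply: cvgM; first exact: cvg_cst); first exact: exprn_continuous.
exact: continuous_norm_powR.
Qed.

Lemma norm_qpoly_le a b c x :
  `|qpoly a b c x| <= (`|a| + `|b| + `|c|) * (1 + x ^+ 2 + `|x| `^ p).
Proof.
have := ler_norm a; have := ler_norm b; have := ler_norm c.
have : - a <= `|a| by rewrite -normrN ler_norm.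
have : - b <= `|b| by rewrite -normrN ler_norm.
have : - c <= `|c| by rewrite -normrN ler_norm.
have := normr_ge0 a; have := normr_ge0 b; have := normr_ge0 c.
have := sqr_ge0 x; have := powR_ge0 `|x| p; rewrite /qpoly.
move: `|a| `|b| `|c| (x ^+ 2) (`|x| `^ p) => A B C X Y.
move=> Y0 X0 C0 B0 A0 c1 b1 a1 c2 b2 a2.
by rewrite ler_norml; apply/andP; split; nra.
Qed.

(** Every such exponent is at most K (1 + x^2 + |x|^p), so the perturbed weight lies below a
    multiple of the weight at (t + eta, s - eta), still admissible. Dividing by K + 1 allows K =
    0. *)
Lemma integrableR_exp_qpoly_gexp t s a b c : admissible p t s ->
  exists2 eta, 0 < eta &
    integrableR (fun x => expR (eta * `|qpoly a b c x|) * gexp p t s x).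
Proof.
move=> /admissible_open[eta eta0 H].
pose K := `|a| + `|b| + `|c|.
have K0 : 0 <= K by rewrite !addr_ge0.
have K1 : 0 < K + 1 by rewrite ltr_wpDl.
exists (eta / (K + 1)); first by rewrite divr_gt0.
have := integrableRZ (expR eta) (integrableR_gexp (H _ (lexx eta))).
apply: le_integrableR => [|x].
  apply: measurable_funM; last exact: measurable_gexp.
  apply: measurableT_comp => //; apply: measurable_funM => //.
  by apply: measurableT_comp => //; exact: measurable_qpoly.
rewrite ger0_norm ?mulr_ge0 ?expR_ge0// /gexp -!expRD ler_expR.
have q0 : 0 <= 1 + x ^+ 2 + `|x| `^ p by rewrite !addr_ge0 ?sqr_ge0 ?powR_ge0.
suff : eta / (K + 1) * `|qpoly a b c x| <= eta * (1 + x ^+ 2 + `|x| `^ p) by lra.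
apply: (@le_trans _ _ (eta / (K + 1) * (K * (1 + x ^+ 2 + `|x| `^ p)))).
  by rewrite ler_wpM2l ?norm_qpoly_le// divr_ge0// ltW.
rewrite mulrA ler_wpM2r// mulrAC ler_pdivrMr//; nra.
Qed.

Definition Zexp t s := intR (gexp p t s).

Lemma Zexp_gt0 t s : integrableR (gexp p t s) -> 0 < Zexp t s.
Proof.
move=> gi.
apply: (@lt_le_trans _ _ (expR (- (`|t| + `|s|)) * (1 - 0))).
  by rewrite subr0 mulr1 expR_gt0.
apply: (intR_ge_itv gi (gexp_ge0 t s)) => // x /andP[x0 x1].
rewrite /gexp ler_expR.
rewrite (ger0_norm x0).
have X1 : x ^+ 2 <= 1 by rewrite exprn_ile1.
have Y1 : x `^ p <= 1.
  have [->|xN] := eqVneq x 0; first by rewrite powR0 ?gt_eqF.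
  by rewrite (le_trans (ge1r_powR _ _))// lt_neqAle eq_sym xN x0.
have := sqr_ge0 x; have := powR_ge0 x p.
have := ler_norm s; have : - t <= `|t| by rewrite -normrN ler_norm.
have := normr_ge0 t; have := normr_ge0 s.
move: (x ^+ 2) (x `^ p) X1 Y1 => X Y X1 Y1; nra.
Qed.

Lemma gexp_scale t s c x : 0 < c ->
  gexp p (t * c ^+ 2) (s * c `^ p) x = gexp p t s (c * x).
Proof.
move=> c0; have E : `|c * x| `^ p = c `^ p * `|x| `^ p.
  by rewrite normrM gtr0_norm// (powRM _ (ltW c0) (normr_ge0 x)).
by rewrite /gexp E; congr expR; ring.
Qed.

Lemma integrableR_gexp_scale t s c : 0 < c -> integrableR (gexp p t s) ->
  integrableR (gexp p (t * c ^+ 2) (s * c `^ p)).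
Proof.
move=> c0 gi.
have -> : gexp p (t * c ^+ 2) (s * c `^ p) = (fun x => gexp p t s (c * x)).
  by apply/funext => x; rewrite gexp_scale.
apply: integrableR_scale gi => //; first exact: continuous_gexp.
by move=> x; exact: gexp_ge0.
Qed.

Lemma Zexp_scale t s c : 0 < c -> integrableR (gexp p t s) ->
  Zexp t s = c * Zexp (t * c ^+ 2) (s * c `^ p).
Proof.
move=> c0 gi; rewrite /Zexp.
have -> : gexp p (t * c ^+ 2) (s * c `^ p) = (fun x => gexp p t s (c * x)).
  by apply/funext => x; rewrite gexp_scale.
have := intR_scale c0 (@continuous_gexp t s) (gexp_ge0 t s) gi.
by move=> ->; rewrite mulVKf// gt_eqF.
Qed.

End Weights.

(** * Lower bound for the volume by tilting and Chernoff bounds *)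

Lemma near_expr_le {R : realType} (a e : R) : 0 <= a < 1 -> 0 < e ->
  \forall n \near \oo, a ^+ n <= e.
Proof.
move=> /andP[a0 a1] e0.
have : (fun n => a ^+ n) @ \oo --> 0 by apply: cvg_expr; rewrite ger0_norm.
move=> /cvgr0_norm_le/(_ _ e0); apply: filterS => n.
by rewrite ger0_norm// exprn_ge0.
Qed.

Section TiltedVolume.
Context {R : realType}.
Variables p t s Y B : R.
Hypothesis p2 : 2 <= p.
Hypothesis adm : admissible p t s.
Hypothesis mean_sqr : intR (fun x => qpoly p 1 0 (- Y) x * gexp p t s x) = 0.
Hypothesis mean_pow : intR (fun x => qpoly p 0 1 (- B) x * gexp p t s x) = 0.

Let w := gexp p t s.
Let Z := Zexp p t s.
Let wi : integrableR w. Proof. exact: integrableR_gexp. Qed.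
Let Z0 : 0 < Z. Proof. exact: Zexp_gt0. Qed.

(** The four one-sided deviations: [j.2] selects u^2 - Y or |u|^p - B, and [j.1 = true] flips the
    sign. *)
Definition deviation (j : bool * bool) : R -> R :=
  let sg := (-1) ^+ j.1 in
  if j.2 then qpoly p sg 0 (- (sg * Y)) else qpoly p 0 sg (- (sg * B)).

Lemma exists_chernoff j d : 0 < d -> exists h, [/\ 0 < h,
  integrableR (fun x => expR (h * (deviation j x - d)) * w x) &
  intR (fun x => expR (h * (deviation j x - d)) * w x) < Z].
Proof.
move=> d0.
have [a [b [c jE]]] : exists a b c, deviation j = qpoly p a b c.
  by case: j => b1 []; do 3 eexists; reflexivity.
have m0 : intR (fun x => deviation j x * w x) = 0.
  case: (j) => b1 [] /=.
  - rewrite -(mulr0 ((-1) ^+ b1)) -mean_sqr -intRZ.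
      apply: eq_intR => x; rewrite mulrA /deviation /qpoly /=; congr (_ * _).
      by move: ((-1) ^+ b1) => sg; ring.
    have [eta eta0 H] := integrableR_exp_qpoly_gexp p2 1 0 (- Y) adm.
    apply: (integrableR_mul_weight eta0 (@gexp_ge0 R p t s) _ _ H).
      exact: measurable_gexp.
    exact: measurable_qpoly.
  - rewrite -(mulr0 ((-1) ^+ b1)) -mean_pow -intRZ.
      apply: eq_intR => x; rewrite mulrA /deviation /qpoly /=; congr (_ * _).
      by move: ((-1) ^+ b1) => sg; ring.
    have [eta eta0 H] := integrableR_exp_qpoly_gexp p2 0 1 (- B) adm.
    apply: (integrableR_mul_weight eta0 (@gexp_ge0 R p t s) _ _ H).
      exact: measurable_gexp.
    exact: measurable_qpoly.
have [eta eta0 H] := integrableR_exp_qpoly_gexp p2 a b c adm.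
rewrite jE in m0 *.
have mw := measurable_gexp p2 t s; have mq := measurable_qpoly p2 a b c.
have [h [h0 he hlt]] := mgf_centered_lt eta0 (@gexp_ge0 R p t s) mw mq H Z0 m0 d0.
exists h; split => //.
have := integrableR_exp_weight (h := h) (@gexp_ge0 R p t s) mw mq H.
rewrite gtr0_norm// => /(_ he) /(integrableRZ (expR (- (h * d)))).
congr integrableR; apply/funext => x; rewrite mulrA -expRD.
by congr (expR _ * _); ring.
Qed.

(** The union bound is made pointwise. The product of the w (x_i), minus its four multiples by exp
    (h_j (D_j - n d)), is nonpositive once some deviation sum D_j exceeds n d; otherwise x lies in
    the target set and the difference is at most exp (n L). Scaled by exp (- n L), it is a signed
    combination of products below the indicator. *)
Lemma tilted_volume_ge delta kappa : B < 1 -> 0 < delta -> 0 < kappa ->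
  \forall n \near \oo,
    ((expR (n%:R * (ln Z - t * Y + s * B - kappa)))%:E <=
     lebesgue_volume [set x : n.-tuple R |
       (\sum_(i < n) `|tnth x i| `^ p <= n%:R)%R /\
       (`|\sum_(i < n) tnth x i ^+ 2 - n%:R * Y| <= n%:R * delta)%R])%E.
Proof.
move=> B1 delta0 kappa0.
have ts0 : 0 < `|t| + `|s| + 1 by rewrite ltr_wpDl// addr_ge0.
(* The three bounds keep S within delta of Y, keep N <= B + d <= 1, and keep the exponent within
   kappa / 2 of its value at the means. *)
pose d := Num.min delta (Num.min (1 - B) (kappa / 2 / (`|t| + `|s| + 1))).
have d0 : 0 < d by rewrite !lt_min delta0 subr_gt0 B1 !divr_gt0.
have d_delta : d <= delta by rewrite ge_min lexx.
have d_B : d <= 1 - B by rewrite /d !ge_min lexx orbT.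
have d_kappa : (`|t| + `|s|) * d <= kappa / 2.
  have : d * (`|t| + `|s| + 1) <= kappa / 2.
    by rewrite -ler_pdivlMr// /d !ge_min lexx !orbT.
  lra.
have /choice[h hP] : forall j, exists h, [/\ 0 < h,
    integrableR (fun x => expR (h * (deviation j x - d)) * w x) &
    intR (fun x => expR (h * (deviation j x - d)) * w x) < Z].
  by move=> j; exact: exists_chernoff.
(* [None] stands for the tilted mass itself, [Some j] for the Chernoff bound on deviation [j]. *)
pose f (o : option (bool * bool)) : R -> R :=
  if o is Some j then fun x => expR (h j * (deviation j x - d)) * w x else w.
pose L := t * Y - s * B + kappa / 2.
pose js := enum {: bool * bool}.
pose r : seq (option (bool * bool)) := None :: map Some js.
pose c n (o : option (bool * bool)) : R :=
  (if o is Some _ then -1 else 1) * expR (- (n%:R * L)).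
have fi o : integrableR (f o) by case: o => [j|//]; have [] := hP j.
have rho j : 0 <= intR (f (Some j)) / Z < 1.
  have [_ _ jZ] := hP j; rewrite ltr_pdivrMr// mul1r jZ andbT divr_ge0 ?(ltW Z0)//.
  by apply: intR_ge0 => x; rewrite mulr_ge0 ?expR_ge0 ?gexp_ge0.
(* Four ratios of at most 1/8 remove at most half of Z^n; the remaining factor 1/2 is absorbed by
   exp (- n kappa / 2). *)
have e8 : 0 < (8 : R)^-1 by rewrite invr_gt0.
have e2 : 0 < (2 : R)^-1 by rewrite invr_gt0.
have ek : 0 <= expR (- (kappa / 2)) < 1.
  by rewrite expR_ge0 expR_lt1 oppr_lt0 divr_gt0.
have nj j := near_expr_le (rho j) e8.
have ns : \forall n \near \oo, forall j, (intR (f (Some j)) / Z) ^+ n <= 8^-1.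
  apply: filterS2 (filterI (nj (true, true)) (nj (true, false)))
                  (filterI (nj (false, true)) (nj (false, false))).
  move=> n [h1 h2] [h3 h4] [[] []];
    [exact: h1|exact: h2|exact: h3|exact: h4].
apply: filterS2 ns (near_expr_le ek e2) => n small half.
have {}small j : intR (f (Some j)) ^+ n <= Z ^+ n / 8.
  by have := small j; rewrite expr_div_n ler_pdivrMr ?exprn_gt0// mulrC.
have {}half : expR (- (n%:R * (kappa / 2))) <= 2^-1.
  by rewrite -mulrN expRM_natl.
apply: (@le_trans _ _ (\sum_(o <- r) c n o * intR (f o) ^+ n)%:E).
  rewrite lee_fin big_cons big_map /c mul1r.
  under eq_bigr do rewrite mulN1r mulNr.
  rewrite sumrN -mulr_sumr -mulrBr.
  have S8 : \sum_(j <- js) intR (f (Some j)) ^+ n <= Z ^+ n / 2.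
    apply: (@le_trans _ _ (\sum_(j <- js) Z ^+ n / 8)); first exact: ler_sum.
    rewrite big_const_seq count_predT iter_addr_0 -cardE card_prod !card_bool.
    by rewrite -mulr_natr; lra.
  have -> : expR (n%:R * (ln Z - t * Y + s * B - kappa)) =
      expR (- (n%:R * L)) * (Z ^+ n * expR (- (n%:R * (kappa / 2)))).
    rewrite -[in Z ^+ n](lnK (x := Z)) ?posrE// -expRM_natl -!expRD.
    by congr expR; rewrite /L; field.
  rewrite ler_wpM2l ?expR_ge0//.
  have Zn : 0 < Z ^+ n by exact: exprn_gt0.
  have : Z ^+ n * expR (- (n%:R * (kappa / 2))) <= Z ^+ n * 2^-1.
    by rewrite ler_wpM2l// ltW.
  rewrite -[intR (f None)]/Z; lra.
apply: lebesgue_volume_ge => // x.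
set Wn := \prod_(i < n) w (tnth x i).
pose D j := \sum_(i < n) deviation j (tnth x i).
have prodE j : \prod_(i < n) f (Some j) (tnth x i) = expR (h j * (D j - n%:R * d)) * Wn.
  rewrite /f big_split /= -expR_sum -mulr_sumr sumrB sumr_const card_ord.
  by rewrite mulr_natl.
have Wn0 : 0 <= Wn by apply: prodr_ge0 => i _; exact: gexp_ge0.
rewrite big_cons big_map /c mul1r.
under eq_bigr do rewrite mulN1r mulNr prodE.
rewrite sumrN -mulr_sumr -mulrBr.
have [[j jd]|noj] := pselect (exists j, n%:R * d < D j).
  apply: (@le_trans _ _ 0); last by rewrite indicE ler0n.
  rewrite pmulr_rle0 ?expR_gt0// subr_le0.
  rewrite (bigD1_seq j) ?mem_enum ?enum_uniq//=.
  apply: (@le_trans _ _ (expR (h j * (D j - n%:R * d)) * Wn)).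
    have [hj _ _] := hP j.
    rewrite ler_peMl// (le_trans _ (expR_ge1Dx _))// lerDl mulr_ge0 ?(ltW hj)//.
    by rewrite subr_ge0 ltW.
  by rewrite lerDl sumr_ge0// => k _; rewrite mulr_ge0 ?expR_ge0.
have Dle j : D j <= n%:R * d by rewrite leNgt; apply/negP => jd; apply: noj; exists j.
pose S := \sum_(i < n) tnth x i ^+ 2; pose N := \sum_(i < n) `|tnth x i| `^ p.
have DS b : D (b, true) = (-1) ^+ b * (S - n%:R * Y).
  rewrite /D /deviation /qpoly /=.
  under eq_bigr do rewrite mul0r addr0 -mulrBr.
  by rewrite -mulr_sumr sumrB sumr_const card_ord mulr_natl.
have DN b : D (b, false) = (-1) ^+ b * (N - n%:R * B).
  rewrite /D /deviation /qpoly /=.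
  under eq_bigr do rewrite mul0r add0r -mulrBr.
  by rewrite -mulr_sumr sumrB sumr_const card_ord mulr_natl.
have n0 : 0 <= n%:R :> R by exact: ler0n.
have S1 : S - n%:R * Y <= n%:R * d by have := Dle (false, true); rewrite DS mul1r.
have S2 : - (S - n%:R * Y) <= n%:R * d.
  by have := Dle (true, true); rewrite DS expr1 mulN1r.
have N1 : N - n%:R * B <= n%:R * d by have := Dle (false, false); rewrite DN mul1r.
have N2 : - (N - n%:R * B) <= n%:R * d.
  by have := Dle (true, false); rewrite DN expr1 mulN1r.
rewrite indicE mem_set; last first.
  split; first by rewrite -/N; nra.
  by rewrite -/S ler_norml; apply/andP; split; nra.
apply: (@le_trans _ _ (expR (- (n%:R * L)) * Wn)).
  rewrite ler_wpM2l ?expR_ge0// lerBlDr lerDl sumr_ge0// => k _.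
  by rewrite mulr_ge0 ?expR_ge0.
have -> : Wn = expR (t * S - s * N).
  by rewrite /Wn /w /gexp -expR_sum sumrB -!mulr_sumr.
rewrite -expRD mulr1n -[leRHS]expR0 ler_expR /L.
have T1 : t * (S - n%:R * Y) <= `|t| * (n%:R * d).
  by rewrite (le_trans (ler_norm _))// normrM ler_wpM2l// ler_norml; apply/andP; split; lra.
have T2 : - (s * (N - n%:R * B)) <= `|s| * (n%:R * d).
  rewrite (le_trans (ler_norm _))// normrN normrM ler_wpM2l// ler_norml.
  by apply/andP; split; lra.
by have := ler_wpM2l n0 d_kappa; lra.
Qed.

End TiltedVolume.

(** * Moments as first-order variations of Z *)

Section Moments.
Context {R : realType}.
Variables p t s : R.
Hypothesis p2 : 2 <= p.
Hypothesis adm : admissible p t s.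
Let w := gexp p t s.
Let p1 : 1 <= p. Proof. by apply: le_trans p2; rewrite ler1n. Qed.

Definition sqr_moment := intR (fun x => x ^+ 2 * gexp p t s x).
Definition pow_moment := intR (fun x => `|x| `^ p * gexp p t s x).

Lemma integrableR_qpoly_gexp a b c :
  integrableR (fun x => qpoly p a b c x * gexp p t s x).
Proof.
have [eta eta0 H] := integrableR_exp_qpoly_gexp p2 a b c adm.
apply: (integrableR_mul_weight eta0 (@gexp_ge0 R p t s) _ _ H).
  exact: measurable_gexp.
exact: measurable_qpoly.
Qed.

Lemma integrableR_sqr_gexp : integrableR (fun x => x ^+ 2 * gexp p t s x).
Proof.
have := integrableR_qpoly_gexp 1 0 0; congr integrableR.
by apply/funext => x; rewrite /qpoly mul1r mul0r !addr0.
Qed.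

Lemma integrableR_pow_gexp : integrableR (fun x => `|x| `^ p * gexp p t s x).
Proof.
have := integrableR_qpoly_gexp 0 1 0; congr integrableR.
by apply/funext => x; rewrite /qpoly mul1r mul0r addr0 add0r.
Qed.

Lemma intR_qpoly_gexp a b c : intR (fun x => qpoly p a b c x * gexp p t s x) =
  a * sqr_moment + b * pow_moment + c * Zexp p t s.
Proof.
have i2 := integrableR_sqr_gexp; have ip := integrableR_pow_gexp.
have iw := integrableR_gexp p2 adm.
rewrite -!intRZ// -!intRD//; try exact: integrableRZ; last first.
  by apply: integrableRD; exact: integrableRZ.
by apply: eq_intR => x; rewrite /qpoly !mulrDl !mulrA.
Qed.

Lemma exp_qpoly_gexp a b c h x :
  expR (h * qpoly p a b c x) * gexp p t s x =
  expR (h * c) * gexp p (t + h * a) (s - h * b) x.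
Proof. by rewrite /gexp -!expRD /qpoly; congr expR; ring. Qed.

(** Moving to (t + h a, s - h b) multiplies the weight by exp (h (a x^2 + b |x|^p)), so the
    conclusion is the slope in h at 0 of the right-hand side of the hypothesis. *)
Lemma qpoly_moment_ge0 a b c delta : 0 < delta ->
  (forall h, 0 < h -> h <= delta ->
     Zexp p t s <= expR (h * c) * Zexp p (t + h * a) (s - h * b)) ->
  0 <= a * sqr_moment + b * pow_moment + c * Zexp p t s.
Proof.
move=> d0 H; rewrite -intR_qpoly_gexp.
have [eta eta0 ie] := integrableR_exp_qpoly_gexp p2 a b c adm.
have mw := measurable_gexp p2 t s; have mq := measurable_qpoly p2 a b c.
pose del := Num.min delta eta.
have del0 : 0 < del by rewrite lt_min d0.
apply: (intR_mul_weight_ge0 eta0 (@gexp_ge0 R p t s) mw mq ie del0) => h h0.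
rewrite le_min => /andP[hd he].
rewrite (le_trans (H h h0 hd))// le_eqVlt; apply/orP; left; apply/eqP.
have := integrableR_exp_weight (h := h) (@gexp_ge0 R p t s) mw mq ie.
rewrite gtr0_norm// => /(_ he) /(integrableRZ (expR (- (h * c)))) ig.
rewrite -intRZ; first by apply: eq_intR => x; exact: esym (exp_qpoly_gexp a b c h x).
move: ig; congr integrableR; apply/funext => x.
by rewrite (exp_qpoly_gexp a b c h x) mulrA -expRD addNr expR0 mul1r.
Qed.

(** The two weights have ratio exp D with |D| <= delta q, q = 1 + x^2 + |x|^p. In |exp D - 1| <= |D|
    exp |D| the factor q costs half of the exponent eta and exp |D| the other half. *)
Lemma Zexp_lipschitz : exists C eta, [/\ 0 <= C, 0 < eta & forall t' s',
  `|t' - t| + `|s' - s| <= eta ->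
  `|Zexp p t' s' - Zexp p t s| <= C * (`|t' - t| + `|s' - s|)].
Proof.
have [eta eta0 ie] := integrableR_exp_qpoly_gexp p2 1 1 1 adm.
pose E x := expR (eta * `|qpoly p 1 1 1 x|) * w x.
exists (2 / eta * intR E), (eta / 2); split; rewrite ?divr_gt0//.
  by rewrite mulr_ge0 ?divr_ge0 ?(ltW eta0)// intR_ge0// => x; rewrite mulr_ge0 ?expR_ge0.
move=> t' s'; set delta := _ + _ => de.
have d0 : 0 <= delta by rewrite addr_ge0.
have Q0 x : 0 <= qpoly p 1 1 1 x.
  by rewrite /qpoly !mul1r !addr_ge0 ?sqr_ge0 ?powR_ge0.
pose D x := (t' - t) * x ^+ 2 - (s' - s) * `|x| `^ p.
have DQ x : `|D x| <= delta * qpoly p 1 1 1 x.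
  rewrite (le_trans (ler_normB _ _))// (normrM (t' - t)) (normrM (s' - s)) (ger0_norm (sqr_ge0 x)).
  rewrite (ger0_norm (powR_ge0 _ _)) /qpoly /delta.
  have := normr_ge0 (t' - t); have := normr_ge0 (s' - s).
  have := sqr_ge0 x; have := powR_ge0 `|x| p.
  by move: `|t' - t| `|s' - s| (x ^+ 2) (`|x| `^ p) => A B X Y; nra.
have gE x : gexp p t' s' x = expR (D x) * w x.
  by rewrite /w /gexp -expRD /D; congr expR; ring.
have DE x : expR `|D x| * w x <= E x.
  rewrite ler_wpM2r ?gexp_ge0// ler_expR (le_trans (DQ x))// ger0_norm//.
  by rewrite ler_wpM2r//; lra.
have ig' : integrableR (gexp p t' s').
  apply: (le_integrableR _ _ ie) => [|x]; first exact: measurable_gexp.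
  rewrite ger0_norm ?gexp_ge0// gE (le_trans _ (DE x))// ler_wpM2r ?gexp_ge0//.
  by rewrite ler_expR ler_norm.
have iw : integrableR w by exact: integrableR_gexp.
have close x : `|gexp p t' s' x - w x| <= delta * (2 / eta) * E x.
  have -> : gexp p t' s' x - w x = (expR (D x) - 1) * w x.
    by rewrite gE mulrBl mul1r.
  rewrite normrM (ger0_norm (gexp_ge0 _ _ _ _)) /E mulrA ler_wpM2r ?gexp_ge0//.
  rewrite (le_trans (norm_expR_sub1_le _))// (ger0_norm (Q0 x)).
  have q2 : qpoly p 1 1 1 x <= 2 / eta * expR (eta / 2 * qpoly p 1 1 1 x).
    rewrite mulrAC ler_pdivlMr// mulrC.
    have := expR_ge1Dx (eta / 2 * qpoly p 1 1 1 x); lra.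
  apply: (@le_trans _ _ (delta * qpoly p 1 1 1 x * expR (eta / 2 * qpoly p 1 1 1 x))).
    rewrite ler_pM ?expR_ge0// ler_expR (le_trans (DQ x))// ler_wpM2r//.
  have -> : expR (eta * qpoly p 1 1 1 x) =
      expR (eta / 2 * qpoly p 1 1 1 x) * expR (eta / 2 * qpoly p 1 1 1 x).
    by rewrite -expRD; congr expR; field.
  by rewrite mulrA ler_wpM2r ?expR_ge0// -mulrA ler_wpM2l.
have iE := integrableRZ (delta * (2 / eta)) ie.
rewrite ler_norml lerNl opprB !lerBlDr /Zexp.
have -> : 2 / eta * intR E * delta = delta * (2 / eta) * intR E by ring.
rewrite -intRZ//; apply/andP; split; rewrite -intRD//;
  apply: le_intR => //; try exact: integrableRD; move=> x;
  rewrite -lerBlDr (le_trans _ (close x))// ?ler_norm//.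
by rewrite -normrN opprB ler_norm.
Qed.

End Moments.

(** * Existence of a tilt with prescribed moments *)

Section TiltExistence.
Context {R : realType}.
Variables p Y r l eps : R.
Hypotheses (p2 : 2 < p) (Y0 : 0 < Y) (Yl : Y < l ^+ 2) (l0 : 0 < l).
Hypotheses (rE : r = l `^ p) (eps0 : 0 < eps).

Let p2' : 2 <= p. Proof. exact: ltW. Qed.
Let p0 : 0 < p. Proof. exact: lt_trans p2. Qed.
Let adm (t s : R) : 0 < s -> admissible p t s.
Proof. by rewrite /admissible gt_eqF. Qed.

Let Phi (z : R * R) : R := expR (z.2 * r - z.1 * Y) * Zexp p z.1 z.2.

Let Phi_intR (t s : R) : 0 < s ->
  Phi (t, s) = intR (fun x => expR (s * r - t * Y) * gexp p t s x).
Proof. by move=> s0; rewrite intRZ//; exact: integrableR_gexp (adm _ s0). Qed.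

Let continuous_Phi (z : R * R) : 0 < z.2 -> Phi z' @[z' --> z] --> Phi z.
Proof.
move=> z0; have [C [eta [C0 eta0 H]]] := Zexp_lipschitz p2' (adm z.1 z0).
have c1 : z'.1 @[z' --> z] --> z.1 by case: (z) => a b; exact: cvg_fst.
have c2 : z'.2 @[z' --> z] --> z.2 by case: (z) => a b; exact: cvg_snd.
apply: cvgM.
  apply: continuous_cvg; first exact: continuous_expR.
  by apply: cvgB; (apply: cvgM; last exact: cvg_cst).
pose g (z' : R * R) := `|z'.1 - z.1| + `|z'.2 - z.2|.
have g_cvg : g z' @[z' --> z] --> (0 : R).
  rewrite -[X in _ --> X](addr0 0); apply: cvgD.
    rewrite -[X in _ --> X](normr0 R) -(subrr z.1); apply: cvg_norm.
    by apply: cvgB => //; exact: cvg_cst.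
  rewrite -[X in _ --> X](normr0 R) -(subrr z.2); apply: cvg_norm.
  by apply: cvgB => //; exact: cvg_cst.
have Cg : C * g z' @[z' --> z] --> (0 : R).
  by rewrite -[X in _ --> X](mulr0 C); apply: cvgM => //; exact: cvg_cst.
have NCg : - (C * g z') @[z' --> z] --> (0 : R).
  by rewrite -[X in _ --> X]oppr0; exact: cvgN.
apply/subr_cvg0; apply: squeeze_cvgr NCg Cg.
near=> z'; have gz' : `|g z'| <= eta by near: z'; exact: cvgr0_norm_le.
rewrite -ler_norml; apply: H; apply: le_trans gz'.
by rewrite ler_norm.
Unshelve. all: by end_near. Qed.

(* The exponent is bounded below by a multiple of |t| + s on a nondegenerate
   interval on which x^2 > Y and |x|^p < r (for t >= 0), respectively x^2 < Y
   and |x|^p < r (for t < 0). *)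
Let coercive_Phi : exists2 c, 0 < c &
  forall t s, 0 < s -> c * (`|t| + s) <= Phi (t, s).
Proof.
have lY : Num.sqrt Y < l.
  by rewrite -(gtr0_norm l0) -sqrtr_sqr ltr_sqrt// exprn_gt0.
have sY : 0 < Num.sqrt Y by rewrite sqrtr_gt0.
pose a := (2 * Num.sqrt Y + l) / 3; pose b := (Num.sqrt Y + 2 * l) / 3.
pose b' := Num.sqrt Y / 2.
have ab : a < b by rewrite /a /b; lra.
have bl : b < l by rewrite /b; lra.
have b0 : 0 < b by rewrite /b; lra.
have b'0 : 0 < b' by rewrite /b'; lra.
have b'b : b' < b by rewrite /b' /b; lra.
have YE : Num.sqrt Y ^+ 2 = Y by rewrite sqr_sqrtr// ltW.
have Ya : Y < a ^+ 2.
  by rewrite -YE ltrXn2r// ?nnegrE; rewrite /a; lra.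
have Yb' : b' ^+ 2 < Y.
  by rewrite -[ltRHS]YE ltrXn2r// ?nnegrE; rewrite /b'; lra.
have rb : b `^ p < r by rewrite rE gt0_ltr_powR// ?nnegrE ltW.
have pow_le x : 0 <= x -> x <= b -> `|x| `^ p <= b `^ p.
  by move=> x0 xb; rewrite ger0_norm// ge0_ler_powR ?nnegrE// ltW.
pose k := Num.min (r - b `^ p) (Num.min (a ^+ 2 - Y) (Y - b' ^+ 2)).
pose m := Num.min (b - a) b'.
have k0 : 0 < k by rewrite !lt_min !subr_gt0 rb Ya.
have m0 : 0 < m by rewrite !lt_min !subr_gt0 ab.
have k1 : k <= r - b `^ p by rewrite /k ge_min lexx.
have k2 : k <= a ^+ 2 - Y by rewrite /k !ge_min lexx orbT.
have k3 : k <= Y - b' ^+ 2 by rewrite /k !ge_min lexx !orbT.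
have m1 : m <= b - a by rewrite /m ge_min lexx.
have m2 : m <= b' - 0 by rewrite /m subr0 ge_min lexx orbT.
exists (k * m) => [|t s s0]; first exact: mulr_gt0.
have e0 : 0 <= expR (k * (`|t| + s)) by exact: expR_ge0.
have : k * (`|t| + s) * m <= expR (k * (`|t| + s)) * m.
  rewrite ler_wpM2r ?(ltW m0)// (le_trans _ (expR_ge1Dx _))// lerDr//.
rewrite mulrAC => /le_trans; apply.
have ig := integrableRZ (expR (s * r - t * Y)) (integrableR_gexp p2' (adm t s0)).
have g0 x : 0 <= expR (s * r - t * Y) * gexp p t s x.
  by rewrite mulr_ge0 ?expR_ge0// gexp_ge0.
rewrite Phi_intR//; have [t0|t0] := leP 0 t.
  apply: (@le_trans _ _ (expR (k * (`|t| + s)) * (b - a))); first by rewrite ler_wpM2l.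
  apply: intR_ge_itv => //; first exact: ltW.
  move=> x /andP[ax xb]; have x0 : 0 <= x by rewrite (le_trans _ ax)// /a; lra.
  rewrite -expRD ler_expR ger0_norm//.
  have := pow_le x x0 xb.
  have : a ^+ 2 <= x ^+ 2 by rewrite lerXn2r// nnegrE// /a; lra.
  have := powR_ge0 `|x| p; move: (x ^+ 2) (`|x| `^ p) => X W W0 X1 W1.
  have h1 : t * k <= t * (X - Y) by rewrite ler_wpM2l//; lra.
  have h2 : s * k <= s * (r - W) by rewrite ler_wpM2l ?(ltW s0)//; lra.
  lra.
apply: (@le_trans _ _ (expR (k * (`|t| + s)) * (b' - 0))); first by rewrite ler_wpM2l.
apply: intR_ge_itv => //; first exact: ltW.
move=> x /andP[x0 xb']; rewrite -expRD ler_expR ltr0_norm//.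
have := pow_le x x0 (le_trans xb' (ltW b'b)).
have : x ^+ 2 <= b' ^+ 2 by rewrite lerXn2r// nnegrE// ltW.
have := powR_ge0 `|x| p; move: (x ^+ 2) (`|x| `^ p) => X W W0 X1 W1.
have h1 : - t * k <= - t * (Y - X) by rewrite ler_wpM2l ?oppr_ge0 ?(ltW t0)//; lra.
have h2 : s * k <= s * (r - W) by rewrite ler_wpM2l ?(ltW s0)//; lra.
lra.
Qed.

Let minimizer_Phi : exists z : R * R,
  eps <= z.2 /\ forall t s, eps <= s -> Phi z <= Phi (t, s).
Proof.
have [c c0 H] := coercive_Phi.
(* By coercivity [Phi] exceeds its value at (0, eps) as soon as |t| + s > M; the summand eps puts
   (0, eps) into the compact box. *)
pose M := Phi (0, eps) / c + eps.
have Phi0 : 0 <= Phi (0, eps).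
  by rewrite /Phi mulr_ge0 ?expR_ge0// intR_ge0// => x; exact: gexp_ge0.
have epsM : eps <= M by rewrite lerDr divr_ge0// ltW.
have M0 : 0 < M by exact: lt_le_trans epsM.
pose A : set (R * R) := `[- M, M]%classic `*` `[eps, M]%classic.
have A0 : A (0, eps).
  by split => /=; rewrite in_itv/= ?lexx ?epsM// oppr_le0 ltW.
have cA : compact A by apply: compact_setX; exact: segment_compact.
have ctA : {within A, continuous Phi}.
  apply/subspace_continuousP => z [_ /=]; rewrite in_itv/= => /andP[ez _].
  apply: cvg_within_filter; apply: continuous_Phi.
  exact: lt_le_trans ez.
have [z zA zmin] := compact_EVT_min (ex_intro _ _ A0) cA ctA.
exists z; split.
  by move: zA; rewrite inE => -[_ /=]; rewrite in_itv/= => /andP[].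
move=> t s es; have [tsM|Mts] := leP (`|t| + s) M.
  apply: zmin; rewrite inE; split => /=; rewrite in_itv/=.
    by rewrite -ler_norml (le_trans _ tsM)// lerDl (le_trans _ es)// ltW.
  by rewrite es (le_trans _ tsM)// lerDr.
apply: (@le_trans _ _ (Phi (0, eps))); first by apply: zmin; rewrite inE.
apply: (le_trans _ (H t s (lt_le_trans eps0 es))).
rewrite mulrC -ler_pdivrMr// (le_trans _ (ltW Mts))// /M lerDl ltW//.
Qed.

(** Karush-Kuhn-Tucker conditions at the minimiser, with B the tilted mean of |u|^p: t moves freely
    both ways, which fixes the second moment; s may always increase, giving B <= r, and may decrease
    unless s = eps, giving B = r. *)
Lemma exists_tilt : exists t s B, [/\ eps <= s, B <= r, s = eps \/ B = r,
  intR (fun x => qpoly p 1 0 (- Y) x * gexp p t s x) = 0 &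
  intR (fun x => qpoly p 0 1 (- B) x * gexp p t s x) = 0].
Proof.
have [[t s] /= [es zmin]] := minimizer_Phi.
have s0 : 0 < s by exact: lt_le_trans es.
have ats := adm t s0.
have Z0 : 0 < Zexp p t s by apply: Zexp_gt0 => //; exact: integrableR_gexp.
have first_order a b delta : 0 < delta ->
    (forall h, 0 < h -> h <= delta -> eps <= s - h * b) ->
    0 <= a * sqr_moment p t s + b * pow_moment p t s -
         (a * Y + b * r) * Zexp p t s.
  move=> d0 hb; rewrite -mulNr; apply: (qpoly_moment_ge0 p2' ats d0) => h h0 hd.
  have := zmin (t + h * a) (s - h * b) (hb h h0 hd); rewrite /Phi /=.
  have -> : (s - h * b) * r - (t + h * a) * Y =
      (s * r - t * Y) + h * - (a * Y + b * r) by ring.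
  by rewrite (expRD (s * r - t * Y)) -mulrA ler_pM2l ?expR_gt0.
have f3 := first_order 0 (-1) 1 ltr01.
have hb0 h : 0 < h -> h <= 1 -> eps <= s - h * 0 by rewrite mulr0 subr0.
have f1 : 0 <= sqr_moment p t s - Y * Zexp p t s.
  by have := first_order 1 0 1 ltr01 hb0; lra.
have f2 : 0 <= - (sqr_moment p t s - Y * Zexp p t s).
  by have := first_order (-1) 0 1 ltr01 hb0; lra.
have {}f3 : 0 <= r * Zexp p t s - pow_moment p t s.
  have : forall h, 0 < h -> h <= 1 -> eps <= s - h * -1.
    by move=> h h0 _; rewrite mulrN1 opprK (le_trans es)// lerDl ltW.
  by move=> /f3; lra.
exists t, s, (pow_moment p t s / Zexp p t s); split => //.
- by rewrite ler_pdivrMr//; lra.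
- have [->|/eqP sne] := pselect (s = eps); [by left|right].
  have se : eps < s by rewrite lt_neqAle eq_sym sne.
  have se' : 0 < s - eps by rewrite subr_gt0.
  have hs h : 0 < h -> h <= s - eps -> eps <= s - h * 1 by lra.
  have f4 := first_order 0 1 (s - eps) se' hs; apply/eqP; rewrite eq_le ler_pdivrMr// ler_pdivlMr//.
  by apply/andP; split; lra.
- by rewrite intR_qpoly_gexp//; lra.
- rewrite intR_qpoly_gexp// mul0r add0r mul1r mulNr divfK ?subrr//.
  by rewrite gt_eqF.
Qed.

End TiltExistence.

(** * The factor |x|^p in even moments at t = 0 *)

Section PowMoment.
Context {R : realType}.
Variables (p : R) (m : nat).
Hypothesis p2 : 2 <= p.
Hypothesis im : forall s : R, 0 < s ->
  integrableR (fun x => x ^+ m.*2 * gexp p 0 s x).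
Let p0 : 0 < p. Proof. exact: lt_le_trans p2. Qed.
Let p1 : 1 <= p. Proof. by apply: le_trans p2; rewrite ler1n. Qed.
Let V (s : R) := intR (fun x => x ^+ m.*2 * gexp p 0 s x).
Let k : R := m.*2.+1%:R.

Let even_ge0 (x : R) : 0 <= x ^+ m.*2.
Proof. by rewrite -mul2n exprM exprn_ge0// sqr_ge0. Qed.

Let V_ge0 s : 0 <= V s.
Proof. by apply: intR_ge0 => x; rewrite mulr_ge0 ?gexp_ge0 ?even_ge0. Qed.

Let V_scale (s c : R) : 0 < c -> 0 < s -> V s = c `^ k * V (s * c `^ p).
Proof.
move=> c0 s0.
have ct : continuous (fun x : R => x ^+ m.*2 * gexp p 0 s x).
  by move=> x; apply: cvgM; [exact: exprn_continuous|exact: continuous_gexp].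
have f0 x : 0 <= x ^+ m.*2 * gexp p 0 s x by rewrite mulr_ge0 ?gexp_ge0 ?even_ge0.
have sc0 : 0 < s * c `^ p by rewrite mulr_gt0// powR_gt0.
have E : (fun x => (c * x) ^+ m.*2 * gexp p 0 s (c * x)) =
         (fun x => c ^+ m.*2 * (x ^+ m.*2 * gexp p 0 (s * c `^ p) x)).
  by apply/funext => x; rewrite -gexp_scale// mul0r exprMn mulrA.
have := intR_scale c0 ct f0 (im s0); rewrite E (intRZ _ (im sc0)).
rewrite -/(V s) -/(V (s * c `^ p)).
have -> : c `^ k = c * c ^+ m.*2 by rewrite powR_mulrn ?(ltW c0)// exprS.
generalize (V s) (V (s * c `^ p)) => A B H.
by rewrite -mulrA H mulVKf// gt_eqF.
Qed.

(* The function s |-> V s * exp (s r), proportional to s^(-k/p) exp (s r), is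
   minimal at s = k / (p r). *)
Lemma intR_pow_even_gexp (s : R) : 0 < s ->
  intR (fun x => `|x| `^ p * (x ^+ m.*2 * gexp p 0 s x)) = k / (p * s) * V s.
Proof.
move=> s0; pose r := k / (p * s).
have k0 : 0 < k by rewrite ltr0n.
have ps0 : 0 < p * s by exact: mulr_gt0.
pose w (x : R) := x ^+ m.*2 * gexp p 0 s x.
have w0 x : 0 <= w x by rewrite mulr_ge0 ?gexp_ge0 ?even_ge0.
have mw : measurable_fun setT w by exact: integrableR_measurable (im s0).
have mp : measurable_fun setT (fun x : R => `|x| `^ p).
  by apply: continuous_measurable_fun; exact: continuous_norm_powR.
have s4 : 0 < s / 4 by rewrite divr_gt0.
have expE (h : R) x : expR (h * `|x| `^ p) * w x = x ^+ m.*2 * gexp p 0 (s - h) x.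
  by rewrite /w mulrCA /gexp -expRD; congr (_ * expR _); ring.
have ie : integrableR (fun x => expR (s / 4 * `| `|x| `^ p|) * w x).
  have := @im (s - s / 4); rewrite [X in 0 < X](_ : _ = 3 * (s / 4)); last by field.
  move=> /(_ (mulr_gt0 _ s4)); rewrite ltr0n => /(_ isT).
  by congr integrableR; apply/funext => x; rewrite ger0_norm ?powR_ge0// expE.
have iw : integrableR w by exact: im.
have ipw := integrableR_mul_weight s4 w0 mw mp ie.
have key (e : R) : e = 1 \/ e = -1 ->
    0 <= intR (fun x => e * (`|x| `^ p - r) * w x).
  move=> e1; have e1' : `|e| = 1 by case: e1 => ->; rewrite ?normrN normr1.
  have me : measurable_fun setT (fun x : R => e * (`|x| `^ p - r)).
    by apply: measurable_funM => //; exact: measurable_funB.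
  have ie' : integrableR (fun x => expR (s / 4 * `|e * (`|x| `^ p - r)|) * w x).
    have := integrableRZ (expR (s / 4 * r)) ie; apply: le_integrableR => [|x].
      apply: measurable_funM => //; apply: measurableT_comp => //.
      by apply: measurable_funM => //; exact: measurableT_comp.
    rewrite ger0_norm ?mulr_ge0 ?expR_ge0// mulrA -expRD ler_wpM2r// ler_expR.
    rewrite -mulrDr ler_wpM2l ?(ltW s4)// normrM e1' mul1r [leRHS]addrC.
    by rewrite (le_trans (ler_normB _ _))// lerD2l ger0_norm// divr_ge0// ltW.
  apply: (intR_mul_weight_ge0 s4 w0 mw me ie' s4) => h h0 hs.
  have he : h * e <= s / 4.
    by rewrite (le_trans (ler_norm _))// normrM e1' mulr1 gtr0_norm.
  have she : 0 < s - h * e by lra.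
  have -> : intR (fun x => expR (h * (e * (`|x| `^ p - r))) * w x) =
      expR (- (h * e * r)) * V (s - h * e).
    rewrite -intRZ; last exact: im.
    by apply: eq_intR => x; rewrite -expE mulrA -expRD; congr (expR _ * _); ring.
  (* This dilation carries s - h e back to s. Minimality becomes (k / p) ln (s / (s - h e)) >= h e
     r, which is ln (1 - z) <= - z at z = h e / s. *)
  pose c := (s / (s - h * e)) `^ p^-1.
  have c0 : 0 < c by rewrite powR_gt0// divr_gt0.
  have cE : (s - h * e) * c `^ p = s.
    rewrite -powRrM mulVf ?gt_eqF// powRr1 ?divr_ge0 ?ltW//.
    by rewrite mulrCA divff ?mulr1// gt_eqF.
  rewrite (V_scale c0 she) cE -[intR w]/(V s) mulrA ler_peMl//.
  rewrite /c -powRrM /powR gt_eqF ?divr_gt0// -expRD (le_trans _ (expR_ge1Dx _))//.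
  rewrite lerDl ln_div ?posrE//.
  have hs1 : - 1 < - (h * e / s) by rewrite ltrN2 ltr_pdivrMr//; lra.
  have := le_ln1Dx hs1.
  have -> : 1 + - (h * e / s) = (s - h * e) / s by field; rewrite gt_eqF.
  rewrite ln_div ?posrE// => lnle.
  have -> : h * e * r = p^-1 * k * (h * e / s).
    by rewrite /r; field; rewrite !gt_eqF.
  rewrite addrC -mulrBr mulr_ge0//; last by lra.
  by rewrite mulr_ge0 ?invr_ge0 ?ltW.
have lin (e : R) : intR (fun x => e * (`|x| `^ p - r) * w x) =
    e * (intR (fun x => `|x| `^ p * w x) - r * V s).
  have irw := integrableRZ (- r) iw.
  transitivity (e * intR (fun x => `|x| `^ p * w x + - r * w x)).
    rewrite -intRZ; last exact: integrableRD.
    by apply: eq_intR => x; rewrite -mulrDl mulrA.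
  by rewrite intRD// intRZ// mulNr.
have := key 1 (or_introl erefl); have := key (-1) (or_intror erefl).
rewrite !lin -/w -/r; lra.
Qed.

End PowMoment.

(** * Lower bounds for the volume of shells *)

(** The exponential growth rate in n of the volume of {sum |x_i|^p <= n}; s = 1/p is the parameter
    at which the p-th moment equals 1. *)
Definition log_volume_const {R : realType} (p : R) : R :=
  p^-1 + ln (Zexp p 0 p^-1).

(* With t1 = t and t2 = 1/p - s this is the quantity maximised in [Fstar p y]. *)
Definition legendre_term {R : realType} (p t s y : R) : R :=
  t * y - s + log_volume_const p - ln (Zexp p t s).

Definition shell {R : realType} (p y delta : R) (n : nat) : set (n.-tuple R) :=
  [set x | (\sum_(i < n) `|tnth x i| `^ p <= n%:R) /\
           (`|\sum_(i < n) tnth x i ^+ 2 - n%:R * y| <= n%:R * delta)].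

Arguments shell {R} p y delta n _.

(** With l = exp (- e), e <= kappa controls the cost - ln l of the dilation, and 1 - l^2 <= 2 e <=
    delta the displacement of the target. *)
Lemma exists_contraction {R : realType} (kappa delta : R) :
  0 < kappa -> 0 < delta -> exists l, [/\ 0 < l, l < 1, - ln l <= kappa &
    forall y, 0 < y <= 1 -> `|l ^+ 2 * y - y| <= delta].
Proof.
move=> k0 d0; pose e := Num.min kappa (delta / 2).
have e0 : 0 < e by rewrite lt_min k0 divr_gt0.
exists (expR (- e)); split; first exact: expR_gt0.
- by rewrite expR_lt1 oppr_lt0.
- by rewrite expRK opprK ge_min lexx.
move=> y /andP[y0 y1]; rewrite -expRM_natl.
have E1 : expR (2 * - e) <= 1 by rewrite expR_le1 mulrN oppr_le0 mulr_ge0// ltW.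
have E2 := expR_ge1Dx (2 * - e).
have e2 : e <= delta / 2 by rewrite ge_min lexx orbT.
by rewrite ler_norml; apply/andP; split; nra.
Qed.

Lemma shell_subset {R : realType} (p Y y d1 d2 : R) n :
  `|Y - y| + d1 <= d2 -> shell p Y d1 n `<=` shell p y d2 n.
Proof.
move=> h x [xN xS]; split => //.
have -> : \sum_(i < n) tnth x i ^+ 2 - n%:R * y =
  (\sum_(i < n) tnth x i ^+ 2 - n%:R * Y) + n%:R * (Y - y) by ring.
rewrite (le_trans (ler_normD _ _))// normrM ger0_norm ?ler0n//.
have n0 : 0 <= n%:R :> R by exact: ler0n.
apply: (le_trans _ (ler_wpM2l n0 h)); lra.
Qed.

Section ShellVolume.
Context {R : realType}.
Variable p : R.
Implicit Types y delta kappa : R.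

(** Rescaling the tilt of the contracted target by l turns its exponent into a Legendre term at y
    itself. The thirds of kappa pay for - ln l, for the slack s (r - B), nonzero only when s = eps,
    and for the loss in [tilted_volume_ge]. *)
Lemma shell_volume_ge_gt2 y delta kappa : 2 < p -> 0 < y < 1 ->
  0 < delta -> 0 < kappa ->
  exists t s, admissible p t s /\ \forall n \near \oo,
    ((expR (n%:R * (log_volume_const p - legendre_term p t s y - kappa)))%:E <=
     lebesgue_volume (shell p y delta n))%E.
Proof.
move=> p2 /andP[y0 y1] d0 k0.
have p2' : 2 <= p by exact: ltW.
have p0 : 0 < p by exact: lt_trans p2.
have k3 : 0 < kappa / 3 by rewrite divr_gt0.
have d2 : 0 < delta / 2 by rewrite divr_gt0.
have [l [l0 l1 lk ly]] := exists_contraction k3 d2.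
pose Y := l ^+ 2 * y.
have l20 : 0 < l ^+ 2 by exact: exprn_gt0.
have Y0 : 0 < Y by exact: mulr_gt0.
have Yl : Y < l ^+ 2 by rewrite /Y -[ltRHS]mulr1 ltr_pM2l.
have r1 : l `^ p < 1.
  have : l `^ p < 1 `^ p by rewrite gt0_ltr_powR// nnegrE ?ler01// ltW.
  by rewrite powR1.
have [t [s [B [es Br seB m2 mp]]]] := exists_tilt p2 Y0 Yl l0 erefl k3.
have s0 : 0 < s by exact: lt_le_trans es.
have adm : admissible p t s by rewrite /admissible gt_eqF.
have ig := integrableR_gexp p2' adm.
have Z0 := Zexp_gt0 p2' ig.
exists (t * l ^+ 2), (s * l `^ p); split.
  by rewrite /admissible gt_eqF// mulr_gt0// powR_gt0.
have := tilted_volume_ge p2' adm m2 mp (le_lt_trans Br r1) d2 k3.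
apply: filterS => n; rewrite -/(shell p Y (delta / 2) n) => H.
have sub : shell p Y (delta / 2) n `<=` shell p y delta n.
  apply: shell_subset; have := ly y; rewrite y0 (ltW y1) => /(_ isT).
  rewrite -/Y; lra.
apply: (le_trans _ (le_trans H (subset_lebesgue_volume sub))).
rewrite lee_fin ler_expR ler_wpM2l// /legendre_term.
have ig' := integrableR_gexp_scale p2' l0 ig.
have Z'0 := Zexp_gt0 p2' ig'.
rewrite (Zexp_scale p2' l0 ig) lnM ?posrE//.
have B0 : 0 <= B.
  have := intR_qpoly_gexp p2' adm 0 1 (- B); rewrite mp mul0r add0r mul1r => E.
  have : 0 <= pow_moment p t s.
    by apply: intR_ge0 => x; rewrite mulr_ge0 ?powR_ge0// gexp_ge0.
  by move: E Z0; move: (Zexp p t s) (pow_moment p t s) => Z M E Z0 M0; nra.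
have sB : s * l `^ p - kappa / 3 <= s * B.
  case: seB => [sE|->]; last by rewrite lerBlDr lerDl ltW.
  apply: (@le_trans _ _ 0); last by rewrite mulr_ge0// ltW.
  by rewrite sE subr_le0 ler_piMr// ltW.
have -> : t * Y = t * l ^+ 2 * y by rewrite /Y mulrA.
lra.
Qed.

(** The two moment conditions coincide, so the centred Gaussian of variance Y, that is t = 0 and s =
    1 / (2 Y), satisfies both with B = Y. The contraction makes Y < 1 even for y = 1. *)
Lemma shell_volume_ge_2 y delta kappa : p = 2 -> 0 < y <= 1 ->
  0 < delta -> 0 < kappa -> \forall n \near \oo,
    ((expR (n%:R * (log_volume_const p + ln y / 2 - kappa)))%:E <=
     lebesgue_volume (shell p y delta n))%E.
Proof.
move=> pE /andP[y0 y1] d0 k0; have p2 : 2 <= p by rewrite pE.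
have k3 : 0 < kappa / 2 by rewrite divr_gt0.
have d2 : 0 < delta / 2 by rewrite divr_gt0.
have [l [l0 l1 lk ly]] := exists_contraction k3 d2.
pose Y := l ^+ 2 * y.
have l20 : 0 < l ^+ 2 by exact: exprn_gt0.
have Y0 : 0 < Y by exact: mulr_gt0.
have Y1 : Y < 1.
  apply: (@le_lt_trans _ _ (l ^+ 2)); first by rewrite ler_piMr// ltW.
  by rewrite exprn_ilt1// ltW.
pose s := (2 * Y)^-1.
have s0 : 0 < s by rewrite invr_gt0 mulr_gt0.
have adm : admissible p 0 s by rewrite /admissible pE eqxx.
have ig := integrableR_gexp p2 adm.
have Z0 := Zexp_gt0 p2 ig.
have pow_m : pow_moment p 0 s = Y * Zexp p 0 s.
  have im (u : R) : 0 < u -> integrableR (fun x => x ^+ 0.*2 * gexp p 0 u x).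
    move=> u0; have : integrableR (gexp p 0 u).
      by apply: integrableR_gexp => //; rewrite /admissible pE eqxx.
    by congr integrableR; apply/funext => x; rewrite expr0 mul1r.
  have := intR_pow_even_gexp p2 im s0.
  under eq_intR do rewrite expr0 mul1r.
  rewrite -[intR _]/(pow_moment p 0 s) => ->; rewrite pE; congr (_ * _).
    by rewrite double0 /s; field; rewrite gt_eqF.
  by apply: eq_intR => x; rewrite expr0 mul1r.
have sqr_m : sqr_moment p 0 s = Y * Zexp p 0 s.
  rewrite -pow_m; apply: eq_intR => x.
  by rewrite pE powR_mulrn// real_normK ?num_real.
have m2 : intR (fun x => qpoly p 1 0 (- Y) x * gexp p 0 s x) = 0.
  by rewrite intR_qpoly_gexp// sqr_m; ring.
have mp : intR (fun x => qpoly p 0 1 (- Y) x * gexp p 0 s x) = 0.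
  by rewrite intR_qpoly_gexp// pow_m; ring.
have := tilted_volume_ge p2 adm m2 mp Y1 d2 k3.
apply: filterS => n; rewrite -/(shell p Y (delta / 2) n) => H.
have sub : shell p Y (delta / 2) n `<=` shell p y delta n.
  apply: shell_subset; have := ly y; rewrite y0 y1 => /(_ isT).
  rewrite -/Y; lra.
apply: (le_trans _ (le_trans H (subset_lebesgue_volume sub))).
rewrite lee_fin ler_expR ler_wpM2l//.
pose c := Num.sqrt Y.
have c0 : 0 < c by rewrite sqrtr_gt0.
have cE : s * c `^ p = p^-1.
  rewrite pE powR_mulrn ?ltW// sqr_sqrtr ?ltW// /s.
  by field; rewrite gt_eqF.
have lnc : ln c = ln l + ln y / 2.
  have e0 : ln (c ^+ 2) = ln (l ^+ 2 * y) by rewrite sqr_sqrtr// ltW.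
  have e1 := lnXn 2 c0; have e2 := lnXn 2 l0.
  have e3 : ln (l ^+ 2 * y) = ln (l ^+ 2) + ln y by apply: lnM; rewrite posrE.
  have := etrans (esym e1) (etrans e0 (etrans e3 (congr1 (fun z => z + ln y) e2))).
  by clear; move: (ln c) (ln l) (ln y) => C L Y'; rewrite (mulr2n C) (mulr2n L); lra.
have sY : s * Y = 2^-1 by rewrite /s; field; rewrite gt_eqF.
have adm' : admissible p 0 p^-1 by rewrite /admissible pE eqxx invr_gt0.
have Z'0 := Zexp_gt0 p2 (integrableR_gexp p2 adm').
rewrite (Zexp_scale p2 c0 ig) mul0r cE lnM ?posrE// lnc sY.
rewrite /log_volume_const.
have pV : p^-1 = 2^-1 by rewrite pE.
by move: (ln _) (p^-1) pV => z q ->; lra.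
Qed.

End ShellVolume.

(** * The Gamma integral under the substitution t = x^p / p *)

Section GammaMoments.
Context {R : realType}.
Variables (p : R) (m : nat).
Hypothesis p2 : 2 <= p.
Let p0 : 0 < p. Proof. exact: lt_le_trans p2. Qed.
Let k : R := m.*2.+1%:R.
Let q : R := k / p.
Let k0 : 0 < k. Proof. by rewrite ltr0n. Qed.
Let q0 : 0 < q. Proof. by rewrite divr_gt0. Qed.
Let mu := @lebesgue_measure R.

(** [F] is the substitution, [G] the integrand of Gamma (1 + q), and [W] the transformed integrand;
    the absolute values make [G] and [W] continuous on the whole line, and [W] even. *)
Let F (x : R) := x `^ p / p.
Let G (t : R) := `|t| `^ q * expR (- t).
Let W (x : R) := p `^ (- q) * (`|x| `^ p * (x ^+ m.*2 * gexp p 0 p^-1 x)).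

Let cG : continuous G.
Proof.
move=> x; apply: cvgM; first exact: continuous_norm_powR.
apply: continuous_comp; last exact: continuous_expR.
exact: opp_continuous.
Qed.

Let G0 x : 0 <= G x. Proof. by rewrite mulr_ge0 ?powR_ge0 ?expR_ge0. Qed.

Let cW : continuous W.
Proof.
move=> x; apply: cvgM; first exact: cvg_cst.
apply: cvgM; first exact: continuous_norm_powR.
by apply: cvgM; [exact: exprn_continuous|exact: continuous_gexp].
Qed.

Let even_ge0 (x : R) : 0 <= x ^+ m.*2.
Proof. by rewrite -mul2n exprM exprn_ge0// sqr_ge0. Qed.

Let W0 x : 0 <= W x.
Proof. by rewrite !mulr_ge0 ?powR_ge0 ?gexp_ge0 ?even_ge0. Qed.

Let F' x : 0 < x -> F^`()%classic x = x `^ (p - 1).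
Proof.
move=> x0; rewrite derive1E /F.
have := is_deriveM (is_derive1_powR p x0) (is_derive_cst p^-1 x 1).
move=> /@derive_val; rewrite /F => ->.
by rewrite /GRing.scale/= mulr0 add0r mulrA mulVf ?mul1r// gt_eqF.
Qed.

Let continuous_powR (a x : R) : 0 < x -> {for x, continuous (fun y : R => y `^ a)}.
Proof.
move=> x0; apply/differentiable_continuous/derivable1_diffP.
by apply: derivable_powR; rewrite in_itv/= andbT.
Qed.

Let cF x : 0 < x -> {for x, continuous F}.
Proof. by move=> x0; apply: cvgM; [exact: continuous_powR|exact: cvg_cst]. Qed.

Let cF' x : 0 < x -> {for x, continuous (F^`()%classic)}.
Proof.
move=> x0; rewrite /prop_for /continuous_at F'//.
have := @continuous_powR (p - 1) x x0.
apply: cvg_trans; apply: near_eq_cvg; near=> y; rewrite F'//.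
by near: y; exact: lt_nbhsr.
Unshelve. all: by end_near. Qed.

Let F00 : F 0 = 0. Proof. by rewrite /F powR0 ?mul0r// gt_eqF. Qed.

Let incrF x y : 0 <= x -> x < y -> F x < F y.
Proof.
move=> x0 xy; rewrite /F ltr_pM2r ?invr_gt0// gt0_ltr_powR// nnegrE//.
by rewrite (le_trans x0)// ltW.
Qed.

Let GF x : 0 < x -> ((G \o F) * F^`()%classic) x = W x.
Proof.
move=> x0; rewrite fctE F'// /G /W /gexp /=.
have Fx0 : 0 <= F x by rewrite divr_ge0 ?powR_ge0// ltW.
rewrite (ger0_norm Fx0) (gtr0_norm x0) mul0r sub0r.
have -> : F x `^ q = p `^ (- q) * x ^+ m.*2.+1.
  rewrite /F powRM ?powR_ge0 ?invr_ge0 ?(ltW p0)// -powRrM.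
  have -> : p * q = k by rewrite /q mulrCA divff ?mulr1// gt_eqF.
  rewrite powR_mulrn ?(ltW x0)// mulrC -powR_inv1 ?(ltW p0)// -powRrM.
  by rewrite mulN1r.
have -> : x `^ p = x * x `^ (p - 1) by rewrite mulr_powRB1// ltW.
have -> : F x = p^-1 * (x * x `^ (p - 1)).
  by rewrite mulr_powRB1 ?(ltW x0)// mulrC.
rewrite exprS; ring.
Qed.

Let substitution n :
  (\int[mu]_(t in `[0%R, F n.+1%:R]) (G t)%:E =
   \int[mu]_(x in `[0%R, n.+1%:R]) (W x)%:E)%E.
Proof.
have n0 : 0 < n.+1%:R :> R by rewrite ltr0n.
rewrite -[in `[0, F _]]F00.
rewrite (@integration_by_substitution_increasing R F G 0 n.+1%:R) ?ler0n//.
- rewrite integral_itv_bndoo; last first.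
    apply/measurable_EFinP; apply: (@eq_measurable_fun _ _ _ _ _ W).
      by move=> x; rewrite inE /= in_itv/= => /andP[x0 _]; rewrite GF.
    by apply: measurable_funTS; exact: continuous_measurable_fun.
  rewrite [RHS]integral_itv_bndoo; last first.
    apply/measurable_EFinP/measurable_funTS.
    exact: continuous_measurable_fun.
  apply: eq_integral => x; rewrite inE /= in_itv/= => /andP[x0 _].
  by rewrite GF.
- by move=> x y; rewrite !in_itv/= => /andP[x0 _] _; exact: incrF.
- by move=> x; rewrite in_itv/= => /andP[x0 _]; exact: cF'.
- apply/cvg_ex; exists 0.
  have := @powR_cvg0 R (p - 1); rewrite subr_gt0 (lt_le_trans _ p2) ?ltr1n//.
  move=> /(_ isT); apply: cvg_trans; apply: near_eq_cvg.
  by near=> y; rewrite F'.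
- apply/cvg_ex; exists (F^`()%classic n.+1%:R).
  by apply: cvg_at_left_filter; exact: cF'.
- split.
  + move=> x; rewrite in_itv/= => /andP[x0 _].
    by apply: derivableM => //; apply: derivable_powR; rewrite in_itv/= andbT.
  + rewrite F00 -[X in _ --> X](mul0r p^-1); apply: cvgM; last exact: cvg_cst.
    exact: powR_cvg0.
  + by apply: cvg_at_left_filter; exact: cF.
- exact: continuous_subspaceT.
Unshelve. all: by end_near. Qed.

Let cvg_itv (H : R -> R) (u : nat -> R) :
  (forall x : R, exists n, x <= u n) ->
  {homo u : x y / (x <= y)%N >-> x <= y} -> continuous H ->
  (forall x, 0 <= H x) ->
  (\int[mu]_(x in `[0%R, u n]) (H x)%:E @[n --> \oo] -->
   \int[mu]_(x in `[0%R, +oo[) (H x)%:E)%E.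
Proof.
move=> hu ndu cH H0.
have <- : \bigcup_n `[0, u n]%classic = `[0, +oo[%classic :> set R.
  apply/seteqP; split => [x [n _]|x] /=; rewrite !in_itv/=.
    by move=> /andP[->].
  rewrite andbT => x0; have [n xn] := hu x; exists n => //=.
  by rewrite in_itv/= x0.
apply: ge0_nondecreasing_set_cvg_integral.
- move=> a b ab; rewrite subsetEset => x /=; rewrite !in_itv/= => /andP[-> xa].
  by rewrite (le_trans xa)// ndu.
- by move=> i; exact: measurable_itv.
- move=> i; apply/measurable_EFinP/measurable_funTS.
  exact: continuous_measurable_fun.
- by move=> i x _; rewrite lee_fin.
Qed.

Let integral_GW :
  (\int[mu]_(t in `[0%R, +oo[) (G t)%:E = \int[mu]_(x in `[0%R, +oo[) (W x)%:E)%E.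
Proof.
have nat_cofinal (x : R) : exists n, x <= n.+1%:R.
  have [x0|x0] := leP 0 x; last by exists 0%N; rewrite ltW// (lt_le_trans x0).
  by exists (Num.truncn x); have /andP[_ /ltW] := truncn_itv x0.
have le1F (x : R) : 1 <= x -> x / p <= F x.
  move=> x1; rewrite /F ler_pM2r ?invr_gt0// le1r_powR//.
  by rewrite (le_trans _ p2)// ler1n.
have cofG (x : R) : exists n, x <= F n.+1%:R.
  have [n xn] := nat_cofinal (x * p); exists n.
  by rewrite (le_trans _ (le1F _ _)) ?ler1n// ler_pdivlMr.
have ndF : {homo (fun n => F n.+1%:R) : a b / (a <= b)%N >-> a <= b}.
  move=> a b; rewrite leq_eqVlt => /predU1P[->//|ab].
  by rewrite ltW// incrF// ltr_nat ltnS.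
have ndn : {homo (fun n => n.+1%:R : R) : a b / (a <= b)%N >-> a <= b}.
  by move=> a b ab; rewrite ler_nat.
have GFn := cvg_itv cofG ndF cG G0.
have WFn := cvg_itv nat_cofinal ndn cW W0.
have E : (fun n => \int[mu]_(x in `[0%R, n.+1%:R]) (W x)%:E)%E =
         (fun n => \int[mu]_(x in `[0%R, F n.+1%:R]) (G x)%:E)%E.
  by apply/funext => n; rewrite substitution.
by rewrite E in WFn; exact: cvg_unique GFn WFn.
Qed.

(** Working with Gamma (1 + q) rather than Gamma q keeps the integrands continuous at 0, at the
    price of the factor |x|^p, which [intR_pow_even_gexp] removes. *)
Lemma Gamma_moment :
  integrableR (fun x => `|x| `^ p * (x ^+ m.*2 * gexp p 0 p^-1 x)) ->
  Gamma (1 + q) = p `^ (- q) / 2 *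
    intR (fun x => `|x| `^ p * (x ^+ m.*2 * gexp p 0 p^-1 x)).
Proof.
move=> iW.
have W2 : (intR W)%:E = (2%:E * \int[mu]_(x in `[0%R, +oo[) (W x)%:E)%E.
  rewrite -intRE; last exact: integrableRZ.
  rewrite (ge0_symfun_integralT W0 cW); last first.
    by move=> x; rewrite /W /gexp /= normrN -mul2n !exprM sqrrN.
  by congr (_ * integral _ _ _)%E; apply/seteqP; split => x /=; rewrite in_itv/= andbT.
rewrite mulrAC -intRZ// -[intR _]/(intR W).
rewrite /Gamma /Rintegral.
have -> : (\int[mu]_(t in `]0%R, +oo[) (t `^ (1 + q - 1) * expR (- t))%:E =
          \int[mu]_(t in `[0%R, +oo[) (G t)%:E)%E.
  rewrite -integral_itv_obnd_cbnd; last first.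
    apply/measurable_EFinP/measurable_funTS.
    exact: continuous_measurable_fun.
  apply: eq_integral => t; rewrite inE /= in_itv/= andbT => t0.
  by rewrite /G gtr0_norm// addrAC subrr add0r.
rewrite integral_GW.
have : (\int[mu]_(x in `[0%R, +oo[) (W x)%:E = (intR W / 2)%:E)%E.
  by rewrite EFinM W2 muleC muleA -EFinM mulVf// mul1e.
by move=> ->.
Qed.

End GammaMoments.

(** * Normalisation and second moment of the generalised Gaussian density *)

Section GaussianConstants.
Context {R : realType}.
Variable p : R.
Hypothesis p2 : 2 <= p.
Let p0 : 0 < p. Proof. exact: lt_le_trans p2. Qed.

Lemma admissible0 (s : R) : 0 < s -> admissible p 0 s.
Proof. by rewrite /admissible; case: ifP. Qed.

Lemma Zexp0_gt0 : 0 < Zexp p 0 p^-1.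
Proof.
apply: Zexp_gt0 => //; apply: integrableR_gexp => //.
by apply: admissible0; rewrite invr_gt0.
Qed.

(** At s = 1/p the factor |x|^p multiplies the integral by exactly 2 m + 1. *)
Lemma Gamma_even_moment m :
  (forall s, 0 < s -> integrableR (fun x => x ^+ m.*2 * gexp p 0 s x)) ->
  integrableR (fun x => `|x| `^ p * (x ^+ m.*2 * gexp p 0 p^-1 x)) ->
  intR (fun x => x ^+ m.*2 * gexp p 0 p^-1 x) =
  2 / m.*2.+1%:R * p `^ (m.*2.+1%:R / p) * Gamma (1 + m.*2.+1%:R / p).
Proof.
move=> im iw; rewrite (Gamma_moment p2 iw) (intR_pow_even_gexp p2 im) ?invr_gt0//.
set V := intR _; set k : R := m.*2.+1%:R.
have k0 : k != 0 by rewrite pnatr_eq0.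
have pk : p `^ (k / p) != 0 by rewrite gt_eqF// powR_gt0.
rewrite powRN divff ?gt_eqF//; field.
by rewrite pk nat1r k0.
Qed.

(** The case m = 0. It identifies [gen_gaussian_pdf] as the normalised weight at (0, 1/p), which
    links [log_mgf] to [Zexp]. *)
Lemma Zexp0_Gamma : Zexp p 0 p^-1 = 2 * p `^ p^-1 * Gamma (1 + p^-1).
Proof.
have adm (s : R) : 0 < s -> admissible p 0 s by exact: admissible0.
have E (f : R -> R) : (fun x => x ^+ 0.*2 * f x) = f.
  by apply/funext => x; rewrite expr0 mul1r.
have := @Gamma_even_moment 0; rewrite -[(0.*2.+1)%:R]/(1 : R) div1r divr1 E => H; apply: H.
  by move=> s s0; rewrite E; exact: integrableR_gexp (adm _ s0).
have := integrableR_pow_gexp p2 (adm p^-1 _); rewrite invr_gt0 => /(_ p0).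
by congr integrableR; apply/funext => x; rewrite expr0 mul1r.
Qed.

Lemma sqr_moment0_Gamma : sqr_moment p 0 p^-1 =
  2 / 3 * p `^ (3 / p) * Gamma (1 + 3 / p).
Proof.
have adm (s : R) : 0 < s -> admissible p 0 s by exact: admissible0.
have pV0 : 0 < p^-1 by rewrite invr_gt0.
have im (s : R) : 0 < s -> integrableR (fun x => x ^+ 1.*2 * gexp p 0 s x).
  by move=> s0; exact: integrableR_sqr_gexp p2 (adm _ s0).
have := @Gamma_even_moment 1 im; rewrite -[(1.*2.+1)%:R]/(3 : R) => H; apply: H.
have [eta eta0 open_adm] := admissible_open (adm _ pV0).
pose e := Num.min eta (p^-1 / 2).
have e0 : 0 < e by rewrite lt_min eta0 divr_gt0.
have eE : e <= p^-1 / 2 by rewrite ge_min lexx orbT.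
have pe0 : 0 < p^-1 - e by lra.
have := integrableRZ e^-1 (im _ pe0); apply: le_integrableR => [|x].
  apply: measurable_funM; last first.
    by apply: measurable_funM; [exact: measurable_funX|exact: measurable_gexp].
  by apply: continuous_measurable_fun; exact: continuous_norm_powR.
have X0 := sqr_ge0 x; have Y0 := powR_ge0 `|x| p.
rewrite ger0_norm; last first.
  by apply: mulr_ge0 => //; apply: mulr_ge0 => //; exact: gexp_ge0.
have -> : gexp p 0 (p^-1 - e) x = expR (e * `|x| `^ p) * gexp p 0 p^-1 x.
  by rewrite /gexp -expRD; congr expR; ring.
rewrite mulrCA [leRHS]mulrCA ler_wpM2l// mulrA ler_wpM2r ?gexp_ge0//.
rewrite ler_pdivlMl//.
by have := expR_ge1Dx (e * `|x| `^ p); lra.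
Qed.

Lemma mp_ge0 : 0 <= mp p. Proof. exact: sqrtr_ge0. Qed.

Lemma sqr_mp : mp p ^+ 2 = sqr_moment p 0 p^-1 / Zexp p 0 p^-1.
Proof.
have Z0 := Zexp0_gt0.
have M0 : 0 <= sqr_moment p 0 p^-1.
  by apply: intR_ge0 => x; rewrite mulr_ge0 ?sqr_ge0 ?gexp_ge0.
suff E : p `^ (2 / p) * Gamma (1 + 3 / p) / (3 * Gamma (1 + p^-1)) =
    sqr_moment p 0 p^-1 / Zexp p 0 p^-1.
  by rewrite /mp sqr_sqrtr E// divr_ge0// ltW.
move: Z0; rewrite sqr_moment0_Gamma Zexp0_Gamma => Z0.
have P0 : 0 < p `^ p^-1 by exact: powR_gt0.
have G0 : Gamma (1 + p^-1) != 0.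
  by apply/eqP => G0; move: Z0; rewrite G0 mulr0 ltxx.
have -> : p `^ (3 / p) = p `^ p^-1 * p `^ (2 / p).
  rewrite -powRD; last by rewrite [p == 0]gt_eqF// implybT.
  by congr powR; field; rewrite gt_eqF.
by field; rewrite G0 gt_eqF.
Qed.

Let log_mgf_integrand (t1 t2 : R) :
  (fun x => (expR (t1 * x ^+ 2 + t2 * `|x| `^ p) * gen_gaussian_pdf p x)%:E) =
  EFin \o (fun x => (Zexp p 0 p^-1)^-1 * gexp p t1 (p^-1 - t2) x).
Proof.
apply/funext => x; congr EFin.
rewrite /gen_gaussian_pdf -Zexp0_Gamma mulrCA -expRD; congr (_ * expR _).
by ring.
Qed.

Lemma log_mgf_integrable (t1 t2 : R) : integrableR (gexp p t1 (p^-1 - t2)) ->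
  log_mgf p t1 t2 = (ln (Zexp p t1 (p^-1 - t2)) - ln (Zexp p 0 p^-1))%:E.
Proof.
move=> gi; rewrite /log_mgf log_mgf_integrand.
have Z0 := Zexp0_gt0; have Z1 := Zexp_gt0 p2 gi.
rewrite (intRE (integrableRZ _ gi)) intRZ// lne_EFin ?mulr_gt0 ?invr_gt0//.
by rewrite mulrC ln_div ?posrE.
Qed.

Lemma log_mgf_not_integrable (t1 t2 : R) :
  ~ integrableR (gexp p t1 (p^-1 - t2)) -> log_mgf p t1 t2 = +oo%E.
Proof.
move=> gi; rewrite /log_mgf log_mgf_integrand.
have Z0 := Zexp0_gt0.
set f := fun x : R => _ * _.
have f0 x : 0 <= f x by rewrite mulr_ge0 ?gexp_ge0// invr_ge0 ltW.
have mf : measurable_fun setT f.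
  by apply: measurable_funM => //; exact: measurable_gexp.
suff -> : (\int[@lebesgue_measure R]_x (EFin \o f) x = +oo)%E by [].
apply/eqP; rewrite -leye_eq leNgt; apply/negP => Ioo; apply: gi.
have fi : integrableR f.
  apply/integrableP; split; first exact/measurable_EFinP.
  rewrite (_ : (fun x => `|(EFin \o f) x|%E) = EFin \o f)//.
  by apply/funext => x /=; rewrite ger0_norm.
have := integrableRZ (Zexp p 0 p^-1) fi; congr integrableR.
by apply/funext => x; rewrite /f mulVKf// gt_eqF.
Qed.

End GaussianConstants.

(** * Duality between Legendre terms and the rate for p > 2 *)

(** Unlike [admissible], this keeps the boundary s = 0. The sign of s is what makes exp (s (n - sum
    |x_i|^p)) >= 1 on the ball. *)
Definition legendre_dom {R : realType} (p t s : R) : Prop :=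
  0 <= s /\ integrableR (gexp p t s).

Section FstarLegendre.
Context {R : realType}.
Variable p : R.
Hypothesis p2 : 2 <= p.
Let p0 : 0 < p. Proof. exact: lt_le_trans p2. Qed.
Implicit Types t s x y a : R.

Lemma legendre_term_le_Fstar t s y : integrableR (gexp p t s) ->
  ((legendre_term p t s y)%:E <= Fstar p y)%E.
Proof.
move=> gi; apply: ereal_sup_ubound => /=; exists t => //; exists (p^-1 - s) => //.
have E : p^-1 - (p^-1 - s) = s by ring.
rewrite log_mgf_integrable// E// -EFinB; congr EFin.
rewrite /legendre_term /log_volume_const.
by generalize (ln (Zexp p t s)) (ln (Zexp p 0 p^-1)) => A B; ring.
Qed.

Lemma lt_Fstar a y : (a%:E < Fstar p y)%E ->
  exists t s, integrableR (gexp p t s) /\ a < legendre_term p t s y.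
Proof.
move=> /ereal_sup_gt[_ [t1 _ [t2 _ <-]]] alt.
exists t1, (p^-1 - t2).
have [gi|ngi] := pselect (integrableR (gexp p t1 (p^-1 - t2))); last first.
  by move: alt; rewrite log_mgf_not_integrable.
split => //; move: alt; rewrite log_mgf_integrable// -EFinB lte_fin.
rewrite /legendre_term /log_volume_const.
generalize (ln (Zexp p t1 (p^-1 - t2))) (ln (Zexp p 0 p^-1)) => A B.
by congr (_ < _); ring.
Qed.

(** Beyond V the power outgrows t x^2 and the weight is at least 1. Hence for p > 2 the supremum in
    [Fstar], although over all t2, only sees s >= 0. *)
Lemma gexp_not_integrable_lt0 t s : 2 < p -> s < 0 -> ~ integrableR (gexp p t s).
Proof.
move=> p2' s0 gi.
have pp : 0 < p - 2 by rewrite subr_gt0.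
have s0' : 0 < - s by rewrite oppr_gt0.
have a0 : 0 <= `|t| / - s by rewrite divr_ge0// ltW.
pose V := (`|t| / - s) `^ (p - 2)^-1.
have V0 : 0 <= V by exact: powR_ge0.
apply: (integrableR_not_ge1 gi (gexp_ge0 p t s) (a := V + 1)) => x Vx.
have x0 : 0 < x by apply: lt_le_trans Vx; rewrite ltr_wpDl.
have Vx' : V <= x by rewrite (le_trans _ Vx)// lerDl.
rewrite /gexp -[leLHS]expR0 ler_expR gtr0_norm//.
have -> : x `^ p = x `^ (p - 2) * x ^+ 2.
  by rewrite -powR_mulrn ?(ltW x0)// -powRD ?subrK// gt_eqF// implybT.
rewrite mulrA -mulrBl mulr_ge0 ?sqr_ge0//.
have : `|t| / - s <= x `^ (p - 2).
  have -> : `|t| / - s = V `^ (p - 2).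
    by rewrite -powRrM mulVf ?gt_eqF// powRr1.
  by rewrite ge0_ler_powR ?nnegrE ?(ltW pp)// ltW.
rewrite ler_pdivrMr//; have : - t <= `|t| by rewrite -normrN ler_norm.
lra.
Qed.

Lemma integrable_gexp_gt2_ge0 t s : 2 < p -> integrableR (gexp p t s) -> 0 <= s.
Proof.
by move=> p2' gi; rewrite leNgt; apply/negP => /(gexp_not_integrable_lt0 (t := t) p2').
Qed.

(** Weak duality at every y >= x: dilating by c = x / y changes ln Z by ln c, which matches the term
    (1/2) ln (y^2 / x^2) = - ln c, and s c^p <= s because s >= 0 and c <= 1. *)
Lemma legendre_term_le_JX_gt2 t s x : 2 < p -> legendre_dom p t s ->
  ((legendre_term p t s (x ^+ 2))%:E <= JX p x)%E.
Proof.
move=> p2' [s0 gi]; rewrite /JX gt_eqF//.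
case: ifP => [/andP[x0 x1]|_]; last by rewrite leey.
apply/ereal_infP => _ [y /= xy <-].
have y0 : 0 < y by exact: lt_le_trans xy.
pose c := x / y.
have c0 : 0 < c by rewrite divr_gt0.
have c1 : c <= 1 by rewrite ler_pdivrMr// mul1r.
have gi' := integrableR_gexp_scale p2 c0 gi.
apply: le_trans (leeD2l _ (legendre_term_le_Fstar _ gi')).
rewrite -EFinD lee_fin /legendre_term (Zexp_scale p2 c0 gi).
have Z0 := Zexp_gt0 p2 gi'.
rewrite [in leLHS]lnM ?posrE//.
have -> : t * c ^+ 2 * y ^+ 2 = t * x ^+ 2.
  by rewrite -mulrA -exprMn /c divfK// gt_eqF.
have -> : ln (y ^+ 2 / x ^+ 2) = - (2 * ln c).
  rewrite -exprVn -exprMn; have -> : y * x^-1 = c^-1 by rewrite /c invfM invrK mulrC.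
  by rewrite exprVn lnV ?posrE ?exprn_gt0// lnXn// mulr_natl.
have cp : c `^ p <= 1.
  by rewrite (le_trans (ge1r_powR _ _)) ?c0// (le_trans _ p2)// ler1n.
have : s * c `^ p <= s by rewrite ler_piMr.
move: (ln (Zexp _ _ _)) (ln c) (log_volume_const p) => A B C; lra.
Qed.

Lemma lt_JX_gt2 a x : 2 < p -> 0 < x < 1 -> (a%:E < JX p x)%E ->
  exists t s, legendre_dom p t s /\ a < legendre_term p t s (x ^+ 2).
Proof.
move=> p2' /[dup] x01 /andP[x0 x1]; rewrite /JX gt_eqF// x01 => alt.
have [t [s [gi H]]] : exists t s, integrableR (gexp p t s) /\
    a < legendre_term p t s (x ^+ 2).
  apply: lt_Fstar; apply: (lt_le_trans alt).
  apply: ereal_inf_lbound; exists x => //=.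
  by rewrite divff ?ln1 ?mulr0 ?add0e// gt_eqF// exprn_gt0.
by exists t, s; split => //; split => //; exact: integrable_gexp_gt2_ge0 gi.
Qed.

(** With s = 0 and t = - c^2 the linear part vanishes at y = 0, while Z is proportional to 1 / c. *)
Lemma legendre_term_unbounded0 a :
  exists t s, legendre_dom p t s /\ a < legendre_term p t s 0.
Proof.
have g1 : integrableR (gexp p (-1) 0).
  have := @integrableT_gauss R; congr integrable; apply/funext => x /=.
  by rewrite /gauss_fun /gexp mulN1r mul0r subr0.
have Z1 := Zexp_gt0 p2 g1.
pose L := a - log_volume_const p + ln (Zexp p (-1) 0) + 1.
pose c := expR L.
have c0 : 0 < c by exact: expR_gt0.
have g2 := integrableR_gexp_scale p2 c0 g1.
have Z2 := Zexp_gt0 p2 g2.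
exists (-1 * c ^+ 2), (0 * c `^ p); split; first by split => //; rewrite mul0r.
rewrite /legendre_term.
have : ln (Zexp p (-1) 0) = L + ln (Zexp p (-1 * c ^+ 2) (0 * c `^ p)).
  by rewrite {1}(Zexp_scale p2 c0 g1) lnM ?posrE// expRK.
rewrite [-1 * _ * 0]mulr0 [0 * _]mul0r /L.
generalize (ln (Zexp p (-1) 0)) (ln (Zexp p (-1 * c ^+ 2) (0 * c `^ p)))
  (log_volume_const p) => A B C; lra.
Qed.

End FstarLegendre.

(** * The same duality for p = 2 *)

Section RateTwo.
Context {R : realType}.
Implicit Types t s x y a : R.
Let two2 : 2 <= 2 :> R. Proof. exact: lexx. Qed.

Let gexp2 t s : gexp 2 t s = gexp 2 0 (s - t).
Proof.
apply/funext => x; rewrite /gexp powR_mulrn// real_normK ?num_real//.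
by congr expR; ring.
Qed.

Let integrable_gexp2 t s : integrableR (gexp 2 t s) -> t < s.
Proof.
rewrite ltNge => gi; apply/negP => st; move: gi => /integrableR_not_ge1.
move=> /(_ (gexp_ge0 2 t s) 0); apply => x _.
rewrite /gexp powR_mulrn// real_normK ?num_real// -[leLHS]expR0 ler_expR.
by rewrite -mulrBl mulr_ge0 ?sqr_ge0// subr_ge0.
Qed.

Let adm2 t s : t < s -> integrableR (gexp 2 t s).
Proof. by move=> ts; apply: integrableR_gexp => //; rewrite /admissible eqxx. Qed.

Let legendre2 t s y : t < s ->
  legendre_term 2 t s y = t * y - s + 2^-1 + ln (2 * (s - t)) / 2.
Proof.
move=> ts; pose a := s - t; have a0 : 0 < a by rewrite subr_gt0.
have a20 : 0 < 2 * a by exact: mulr_gt0.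
pose c := expR (- (ln (2 * a) / 2)).
have c0 : 0 < c by exact: expR_gt0.
have E : Zexp 2 t s = c * Zexp 2 0 2^-1.
  rewrite /Zexp gexp2 -/(Zexp _ _ _) (Zexp_scale two2 c0 (adm2 a0)) mul0r.
  congr (_ * Zexp _ _ _); rewrite powR_mulrn ?(ltW c0)// /c -expRM_natl.
  have -> : 2 * - (ln (2 * a) / 2) = - ln (2 * a) by field.
  by rewrite expRN lnK ?posrE// invfM mulrCA divff ?mulr1// gt_eqF.
have Z0 := Zexp_gt0 two2 (adm2 (_ : 0 < 2^-1 :> R)).
rewrite /legendre_term /log_volume_const E lnM ?posrE ?Z0 ?invr_gt0//.
rewrite /c expRK /a; lra.
Qed.

(** This is ln z <= z - 1 at z = 2 (s - t) x^2, combined with s x^2 <= s. *)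
Lemma legendre_term_le_JX_2 t s x : 0 <= x -> legendre_dom 2 t s ->
  ((legendre_term 2 t s (x ^+ 2))%:E <= JX 2 x)%E.
Proof.
move=> x0 [s0 gi]; rewrite /JX eqxx; case: ifP => [/andP[x0' x1]|_]; last by rewrite leey.
have ts := integrable_gexp2 gi; rewrite lee_fin legendre2//.
have a20 : 0 < 2 * (s - t) by rewrite mulr_gt0// subr_gt0.
have y0 : 0 < x ^+ 2 by exact: exprn_gt0.
have y1 : x ^+ 2 <= 1 by rewrite exprn_ile1// ltW.
have := @le_ln1Dx R (2 * (s - t) * x ^+ 2 - 1).
rewrite ltrBrDl subrr mulr_gt0// => /(_ isT).
rewrite addrC subrK lnM ?posrE// lnXn// (mulr2n (ln x)).
have : s * x ^+ 2 <= s by rewrite ler_piMr.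
move: (ln (2 * (s - t))) (ln x) => A B; lra.
Qed.

Lemma lt_JX_2 a x : 0 < x -> (a%:E < JX 2 x)%E ->
  exists t s, legendre_dom 2 t s /\ a < legendre_term 2 t s (x ^+ 2).
Proof.
move=> x0; rewrite /JX eqxx x0 andTb; have [x1|x1] := leP x 1.
  rewrite lte_fin => alt.
  have y0 : 0 < x ^+ 2 by exact: exprn_gt0.
  (* The equality case 2 (s - t) x^2 = 1 with s = 0. *)
  pose t := - (2 * x ^+ 2)^-1.
  have t0 : t < 0 by rewrite oppr_lt0 invr_gt0 mulr_gt0.
  exists t, 0; split; first by split => //; exact: adm2.
  rewrite legendre2//.
  have -> : 2 * (0 - t) = (x ^+ 2)^-1 by rewrite /t; field; rewrite gt_eqF.
  have -> : t * x ^+ 2 = - 2^-1 by rewrite /t; field; rewrite gt_eqF.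
  rewrite lnV ?posrE// lnXn// (mulr2n (ln x)).
  by move: alt; move: (ln x) => A; lra.
move=> _; have y1 : 0 < x ^+ 2 - 1 by rewrite subr_gt0 exprn_egt1// ?ltW.
(* Along t = s - 1/2 the Gaussian integral is constant and the term equals s (x^2 - 1) - x^2 / 2 +
   1/2, which this s pushes above a. *)
pose s := (`|a| + x ^+ 2) / (x ^+ 2 - 1).
have s0 : 0 <= s by apply: divr_ge0; [rewrite addr_ge0// sqr_ge0|exact: ltW].
have ts : s - 2^-1 < s by rewrite ltrBlDr ltrDl invr_gt0.
exists (s - 2^-1), s; split; first by split => //; exact: adm2.
rewrite legendre2//.
have -> : 2 * (s - (s - 2^-1)) = 1 by field.
have sE : s * (x ^+ 2 - 1) = `|a| + x ^+ 2 by rewrite /s divfK// gt_eqF.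
rewrite ln1; have := ler_norm a; have := sqr_ge0 x; lra.
Qed.

End RateTwo.

(** * Infinite rate at y >= 1 for p > 2 *)

Section Concentration.
Context {R : realType}.
Variable p : R.
Hypothesis p2 : 2 < p.
Let p2' : 2 <= p. Proof. exact: ltW. Qed.
Let p0 : 0 < p. Proof. exact: lt_trans p2. Qed.

(** The slack in Young's inequality x^2 <= (2/p) |x|^p + (1 - 2/p). *)
Let gap (x : R) := 2 / p * `|x| `^ p - x ^+ 2 + (1 - 2 / p).

(** With v = x^2, |x|^p = v exp ((p/2 - 1) ln v); then exp z > 1 + z for z nonzero, and v ln v >= v
    - 1. *)
Let gap_gt0 x : x ^+ 2 != 1 -> 0 < gap x.
Proof.
move=> x1; rewrite /gap.
have q1 : 2 / p < 1 by rewrite ltr_pdivrMr// mul1r.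
have [->|xN0] := eqVneq x 0.
  by rewrite normr0 powR0 ?gt_eqF// expr0n/= mulr0 subr0 add0r subr_gt0.
have x0 : 0 < `|x| by rewrite normr_gt0.
pose v := x ^+ 2.
have v0 : 0 < v by rewrite /v -real_normK ?num_real// exprn_gt0.
have -> : `|x| `^ p = v * expR ((p / 2 - 1) * ln v).
  rewrite -{1}(lnK (x := v)) ?posrE// -expRD /powR gt_eqF//; congr expR.
  have -> : ln v = ln `|x| *+ 2 by rewrite /v -real_normK ?num_real// lnXn.
  by rewrite mulr2n; field.
have lv : ln v != 0 by rewrite ln_eq0.
have h1 : 1 + (p / 2 - 1) * ln v < expR ((p / 2 - 1) * ln v).
  apply: expR_gt1Dx; rewrite mulf_neq0// gt_eqF// subr_gt0.
  by rewrite ltr_pdivlMr// mul1r.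
have h2 : v - 1 <= v * ln v.
  have := @le_ln1Dx R (v^-1 - 1); rewrite ltrBrDl subrr invr_gt0 => /(_ v0).
  rewrite addrC subrK lnV ?posrE// => h.
  have : v * - ln v <= v * (v^-1 - 1) by rewrite ler_wpM2l// ltW.
  by rewrite mulrBr mulfV ?gt_eqF//; lra.
rewrite -/v.
have h3 : v * (1 + (p / 2 - 1) * ln v) < v * expR ((p / 2 - 1) * ln v).
  by rewrite ltr_pM2l.
have h4 : (p / 2 - 1) * (v - 1) <= (p / 2 - 1) * (v * ln v).
  by rewrite ler_wpM2l// subr_ge0 ler_pdivlMr// mul1r.
have h5 : v + (p / 2 - 1) * (v - 1) < v * expR ((p / 2 - 1) * ln v) by lra.
have : 2 / p * (v + (p / 2 - 1) * (v - 1)) <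
       2 / p * (v * expR ((p / 2 - 1) * ln v)).
  by rewrite ltr_pM2l// divr_gt0.
have -> : 2 / p * (v + (p / 2 - 1) * (v - 1)) = v - 1 + 2 / p.
  by field; rewrite gt_eqF.
by lra.
Qed.

Let gap_eq0 x : x ^+ 2 = 1 -> gap x = 0.
Proof.
move=> x1; have : `|x| = 1.
  by have /eqP := x1; rewrite sqrf_eq1 => /orP[]/eqP->; rewrite ?normrN normr1.
by rewrite /gap x1 => ->; rewrite powR1; ring.
Qed.

Let gap_exp n x : gexp p n%:R (n%:R * (2 / p)) x =
  expR (n%:R * (1 - 2 / p)) * expR (- gap x) ^+ n.
Proof.
by rewrite -expRM_natl -expRD /gexp /gap; congr expR; ring.
Qed.

Let integrable_gap n : (0 < n)%N -> integrableR (fun x => expR (- gap x) ^+ n).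
Proof.
move=> n0.
have : integrableR (gexp p n%:R (n%:R * (2 / p))).
  apply: integrableR_gexp => //; rewrite /admissible gt_eqF//.
  by rewrite mulr_gt0 ?ltr0n// divr_gt0.
move=> /(integrableRZ (expR (- (n%:R * (1 - 2 / p))))); congr integrableR.
apply/funext => x; rewrite gap_exp mulrA -expRD.
by rewrite addNr expR0 mul1r.
Qed.

(** Powers of exp (- gap) decrease to the indicator of {-1, 1}, a null set, and dominated
    convergence applies with the first power as bound. *)
Let cvg_gap (e : R) : 0 < e ->
  exists2 n, (0 < n)%N & intR (fun x => expR (- gap x) ^+ n) < e.
Proof.
move=> e0.
pose A : set R := [set x | x ^+ 2 = 1].
have AE : A = [set 1; -1].
  apply/seteqP; split => x; rewrite /A /=; last by case=> ->; rewrite ?sqrrN expr1n.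
  by move=> /eqP; rewrite sqrf_eq1 => /orP[/eqP ->|/eqP ->]; [left|right].
have mA : measurable A by rewrite AE; exact: measurableU.
have A0 : lebesgue_measure A = 0%E.
  by rewrite AE; apply: countable_lebesgue_measure0; exact: finite_set_countable.
have pointwise x : expR (- gap x) ^+ n.+1 @[n --> \oo] --> (\1_A x : R).
  have [xA|xA] := pselect (A x).
    rewrite indicE mem_set// gap_eq0// oppr0 expR0.
    by under eq_fun do rewrite expr1n; exact: cvg_cst.
  rewrite indicE memNset// (cvg_shiftS (fun n => expR (- gap x) ^+ n)).
  apply: cvg_expr; rewrite gtr0_norm ?expR_gt0// expR_lt1 oppr_lt0 gap_gt0//.
  exact/eqP.
have gap0 x : 0 <= gap x.
  have [/gap_eq0->//|/gap_gt0/ltW//] := eqVneq (x ^+ 2) 1.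
have [|||||_ _ H] := @dominated_convergence _ _ R (@lebesgue_measure R) setT measurableT
  (fun n x => (expR (- gap x) ^+ n.+1)%:E) (fun x => (\1_A x)%:E)
  (fun x => (expR (- gap x) ^+ 1)%:E).
- by move=> n; exact: measurable_int (integrable_gap (ltn0Sn n)).
- by apply/measurable_EFinP; exact: measurable_indic.
- by apply: aeW => x _; apply: cvg_EFin; [exact: nearW|exact: pointwise].
- exact: (integrable_gap (ltn0Sn 0)).
- apply: aeW => x n _; rewrite /= lee_fin ger0_norm ?exprn_ge0 ?expR_ge0//.
  rewrite exprS expr1 ler_piMr ?expR_ge0// exprn_ile1 ?expR_ge0//.
  by rewrite expR_le1 oppr_le0.
have {}H : (intR (fun x => expR (- gap x) ^+ n.+1))%:E @[n --> \oo] --> (0 : R)%:E.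
  have I0 : (\int[@lebesgue_measure R]_x (\1_A x)%:E = 0)%E.
    by rewrite integral_indic// setIT; exact: A0.
  move: H; rewrite I0.
  have -> : (fun n => (intR (fun x => expR (- gap x) ^+ n.+1))%:E) =
      (fun n => \int[@lebesgue_measure R]_x (expR (- gap x) ^+ n.+1)%:E)%E.
    by apply/funext => n; rewrite intRE//; exact: integrable_gap.
  exact.
have /filter_ex[n hn] : \forall n \near \oo,
    intR (fun x => expR (- gap x) ^+ n.+1) < e.
  exact: (cvgr_lt _ (fine_cvg H) _ e0).
by exists n.+1.
Qed.

(** At t = n, s = 2 n / p the term is n (y - 1) plus a constant minus the logarithm of an integral
    that tends to 0. *)
Lemma legendre_term_unbounded_ge1 (a y : R) : 1 <= y ->
  exists t s, legendre_dom p t s /\ a < legendre_term p t s y.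
Proof.
move=> y1; have [n n0 hn] := @cvg_gap (expR (log_volume_const p - a)) (expR_gt0 _).
have adm : admissible p n%:R (n%:R * (2 / p)).
  by rewrite /admissible gt_eqF// mulr_gt0 ?ltr0n// divr_gt0.
have gi := integrableR_gexp p2' adm.
exists n%:R, (n%:R * (2 / p)); split.
  by split => //; rewrite mulr_ge0// divr_ge0// ltW.
have I0 : 0 < intR (fun x => expR (- gap x) ^+ n).
  have := Zexp_gt0 p2' gi; rewrite /Zexp.
  under eq_intR do rewrite gap_exp.
  by rewrite intRZ ?pmulr_rgt0 ?expR_gt0//; exact: integrable_gap.
have ZE : ln (Zexp p n%:R (n%:R * (2 / p))) =
    n%:R * (1 - 2 / p) + ln (intR (fun x => expR (- gap x) ^+ n)).
  rewrite /Zexp; under eq_intR do rewrite gap_exp.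
  rewrite intRZ; last exact: integrable_gap.
  by rewrite lnM ?posrE ?expR_gt0// expRK.
have : ln (intR (fun x => expR (- gap x) ^+ n)) < log_volume_const p - a.
  by rewrite -ltr_expR lnK.
have : n%:R <= n%:R * y by rewrite ler_peMr.
rewrite /legendre_term ZE; lra.
Qed.

End Concentration.

(** * The rate as a supremum of Legendre terms, for all p >= 2 *)

Section RateFunction.
Context {R : realType}.
Variable p : R.
Hypothesis p2 : 2 <= p.
Implicit Types t s x a : R.

Lemma legendre_term_le_JX t s x : 0 <= x -> legendre_dom p t s ->
  ((legendre_term p t s (x ^+ 2))%:E <= JX p x)%E.
Proof.
move=> x0; have [->|pN2] := eqVneq p 2; first exact: legendre_term_le_JX_2.
by apply: legendre_term_le_JX_gt2 => //; rewrite lt_neqAle eq_sym pN2.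
Qed.

(** Together with [legendre_term_le_JX], this presents the rate on x >= 0 as a supremum of functions
    continuous in x, including the points where it is infinite. Semicontinuity and the covering
    argument both rest on it. *)
Lemma lt_JX a x : 0 <= x -> (a%:E < JX p x)%E ->
  exists t s, legendre_dom p t s /\ a < legendre_term p t s (x ^+ 2).
Proof.
rewrite le_eqVlt => /predU1P[<- _|x0].
  by rewrite expr0n/=; exact: legendre_term_unbounded0.
have [->|pN2] := eqVneq p 2; first exact: lt_JX_2.
have p2' : 2 < p by rewrite lt_neqAle eq_sym pN2.
have [x1|x1] := ltP x 1; first by apply: lt_JX_gt2; rewrite ?x0.
by move=> _; apply: legendre_term_unbounded_ge1 => //; rewrite exprn_ege1.
Qed.

Lemma JX_support x : (JX p x < +oo)%E -> 0 < x <= 1.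
Proof.
rewrite /JX; case: ifP => _; first by case: ifP.
by case: ifP => // /andP[-> /ltW].
Qed.

End RateFunction.

(** * Minimiser, lower semicontinuity and compact level sets *)

Section RateMinimum.
Context {R : realType}.
Variable p : R.
Hypothesis p2 : 2 <= p.
Let p0 : 0 < p. Proof. exact: lt_le_trans p2. Qed.
Let pV0 : 0 < p^-1. Proof. by rewrite invr_gt0. Qed.
Let adm : admissible p 0 p^-1. Proof. exact: admissible0. Qed.
Let Z0 : 0 < Zexp p 0 p^-1. Proof. exact: Zexp0_gt0. Qed.

Lemma legendre_dom0 : legendre_dom p 0 p^-1.
Proof. by split; [exact: ltW|exact: integrableR_gexp]. Qed.

Lemma legendre_term0 y : legendre_term p 0 p^-1 y = 0.
Proof. by rewrite /legendre_term /log_volume_const; ring. Qed.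

Lemma JX_ge0 x : (0 <= JX p x)%E.
Proof.
have [x0|x0] := leP 0 x.
  have := legendre_term_le_JX p2 x0 legendre_dom0.
  by rewrite legendre_term0.
rewrite leNgt; apply/negP => J0.
have /JX_support/andP[] : (JX p x < +oo)%E by exact: lt_trans J0 (ltry 0).
by move=> /(lt_trans x0); rewrite ltxx.
Qed.

Lemma pow_moment0 : pow_moment p 0 p^-1 = Zexp p 0 p^-1.
Proof.
have im (u : R) : 0 < u -> integrableR (fun x => x ^+ 0.*2 * gexp p 0 u x).
  move=> u0; have := integrableR_gexp p2 (admissible0 p u0).
  by congr integrableR; apply/funext => x; rewrite expr0 mul1r.
have := intR_pow_even_gexp p2 im pV0.
under eq_intR do rewrite expr0 mul1r.
rewrite -[intR _]/(pow_moment p 0 p^-1) => ->.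
rewrite double0 divff ?gt_eqF// divr1 mul1r.
by apply: eq_intR => x; rewrite expr0 mul1r.
Qed.

(* Jensen's inequality for exp under the density proportional to
   exp (- |x|^p / p), whose second moment is (mp p)^2 and p-th moment 1. *)
Lemma Zexp_jensen t s : integrableR (gexp p t s) ->
  t * mp p ^+ 2 - s + p^-1 + ln (Zexp p 0 p^-1) <= ln (Zexp p t s).
Proof.
move=> gi; pose m := t * mp p ^+ 2 - s + p^-1.
have w0i := integrableR_gexp p2 adm.
have iq := integrableR_qpoly_gexp p2 adm t (p^-1 - s) (1 - m).
have Z1 := Zexp_gt0 p2 gi.
rewrite -/m; apply: add_ln_le => //.
have <- : intR (fun x => qpoly p t (p^-1 - s) (1 - m) x * gexp p 0 p^-1 x) =
    Zexp p 0 p^-1.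
  rewrite intR_qpoly_gexp// pow_moment0 /m sqr_mp//.
  by field; rewrite !gt_eqF.
rewrite -intRZ//; apply: le_intR => //; first exact: integrableRZ.
move=> x.
have -> : gexp p t s x =
    expR m * (expR (qpoly p t (p^-1 - s) (- m) x) * gexp p 0 p^-1 x).
  by rewrite /gexp /qpoly -!expRD; congr expR; ring.
rewrite ler_pM2l ?expR_gt0// ler_wpM2r ?gexp_ge0//.
apply: (le_trans _ (expR_ge1Dx _)); rewrite /qpoly; lra.
Qed.

Lemma JX_mp : JX p (mp p) = 0%E.
Proof.
apply/eqP; rewrite eq_le JX_ge0 andbT leNgt; apply/negP.
move=> /(lt_JX p2 (mp_ge0 p))[t [s [[_ gi]]]].
have := Zexp_jensen gi; rewrite /legendre_term /log_volume_const.
by generalize (ln (Zexp p t s)) (ln (Zexp p 0 p^-1)) => A B; lra.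
Qed.

(** If the rate vanishes at x, the terms at (h, 1/p) give h x^2 <= ln (Z(h, 1/p) / Z(0, 1/p)) <= h
    (mp p)^2 + O(h^2); the two signs of h force equality of the squares. *)
Lemma JX_le0_mp x : (JX p x <= 0)%E -> x = mp p.
Proof.
move=> J0; have /JX_support/andP[x0 _] : (JX p x < +oo)%E.
  exact: le_lt_trans J0 (ltry 0).
have [eta eta0 ie] := integrableR_exp_qpoly_gexp p2 1 0 0 adm.
have mw := measurable_gexp p2 0 p^-1; have mq := measurable_qpoly p2 1 0 0.
have [C C0 HC] := mgf_quadratic_le eta0 (@gexp_ge0 R p 0 p^-1) mw mq ie.
have key h : `|h| <= eta / 2 ->
    h * x ^+ 2 <= h * mp p ^+ 2 + C / Zexp p 0 p^-1 * h ^+ 2.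
  move=> he.
  have gE : (fun y => expR (h * qpoly p 1 0 0 y) * gexp p 0 p^-1 y) = gexp p h p^-1.
    by apply/funext => y; rewrite /gexp /qpoly -expRD; congr expR; ring.
  have he' : `|h| <= eta by apply: (le_trans he); rewrite ler_pdivrMr// ler_peMr ?ler1n// ltW.
  have gi := integrableR_exp_weight (@gexp_ge0 R p 0 p^-1) mw mq ie he'.
  rewrite gE in gi.
  have dom : legendre_dom p h p^-1 by split => //; exact: ltW.
  have := le_trans (legendre_term_le_JX p2 (ltW x0) dom) J0.
  rewrite lee_fin /legendre_term /log_volume_const => L.
  have := HC h he; rewrite gE intR_qpoly_gexp// mul0r mul0r !addr0 mul1r.
  rewrite -/(Zexp p 0 p^-1) -/(Zexp p h p^-1) => Zle.
  have Z1 := Zexp_gt0 p2 gi.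
  pose u := h * mp p ^+ 2 + C / Zexp p 0 p^-1 * h ^+ 2.
  have Zu : Zexp p h p^-1 <= Zexp p 0 p^-1 * expR u.
    apply: (le_trans Zle); apply: (le_trans _ (ler_wpM2l (ltW Z0) (expR_ge1Dx u))).
    rewrite le_eqVlt; apply/orP; left; apply/eqP; rewrite /u sqr_mp//.
    by field; rewrite gt_eqF.
  have : ln (Zexp p h p^-1) <= ln (Zexp p 0 p^-1) + u.
    exact: ln_le_add.
  move: L; rewrite -/u; clearbody u.
  by generalize (ln (Zexp p h p^-1)) (ln (Zexp p 0 p^-1)) => A B; clear; lra.
have e2 : 0 < eta / 2 by rewrite divr_gt0.
have le1 : 0 <= mp p ^+ 2 - x ^+ 2.
  apply: (@ge0_slope R _ (C / Zexp p 0 p^-1) _ e2) => h h0 he.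
  by have := key h; rewrite gtr0_norm// => /(_ he); lra.
have le2 : 0 <= x ^+ 2 - mp p ^+ 2.
  apply: (@ge0_slope R _ (C / Zexp p 0 p^-1) _ e2) => h h0 he.
  by have := key (- h); rewrite normrN gtr0_norm// => /(_ he); rewrite sqrrN; lra.
have E : x ^+ 2 = mp p ^+ 2 by apply/eqP; rewrite eq_le; apply/andP; split; lra.
by apply/eqP; rewrite -(eqrXn2 (n := 2)) ?mp_ge0 ?(ltW x0)// E.
Qed.

Lemma JX_argmin : [set x : R | forall y : R, (JX p x <= JX p y)%E] = [set mp p].
Proof.
apply/seteqP; split => x /=.
  by move=> /(_ (mp p)); rewrite JX_mp => /JX_le0_mp.
by move=> -> y; rewrite JX_mp JX_ge0.
Qed.

Lemma JX_npos x : x <= 0 -> JX p x = +oo%E.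
Proof.
move=> x0; apply/eqP; rewrite -leye_eq leNgt; apply/negP => /JX_support/andP[+ _].
by rewrite ltNge x0.
Qed.

Lemma continuous_legendre_term t s :
  continuous (fun x : R => legendre_term p t s (x ^+ 2)).
Proof.
move=> x; apply: cvgB; last exact: cvg_cst.
apply: cvgD; last exact: cvg_cst.
apply: cvgB; last exact: cvg_cst.
by apply: cvgM; [exact: cvg_cst|exact: exprn_continuous].
Qed.

Lemma lower_semicontinuous_JX : lower_semicontinuous (JX p).
Proof.
move=> x a ax; have [x0|x0] := leP 0 x; last first.
  exists [set y | y < 0]; first exact: open_nbhs_nbhs.
  by move=> y /= /ltW /JX_npos ->; rewrite ltry.
have [t [s [dom H]]] := lt_JX p2 x0 ax.
pose f y := legendre_term p t s (y ^+ 2).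
have cf : continuous f by exact: continuous_legendre_term.
exists [set y | a < f y]; first exact: (cvgr_gt _ (cf x) _ H).
move=> y /= fy; have [y0|y0] := leP 0 y.
  by rewrite (lt_le_trans _ (legendre_term_le_JX p2 y0 dom))// lte_fin.
by rewrite JX_npos ?ltry// ltW.
Qed.

Lemma compact_level_sets_JX : compact_level_sets (JX p).
Proof.
move=> a; apply: (@subclosed_compact _ _ `[0 : R, 1]%classic).
- have -> : [set x | (JX p x <= a%:E)%E] = ~` [set x | (a%:E < JX p x)%E].
    by apply/seteqP; split => x /=; rewrite leNgt => /negP.
  apply: open_closedC.
  by have /lower_semicontinuousP := lower_semicontinuous_JX; apply.
- exact: segment_compact.
- move=> x /= Jx; have /JX_support/andP[x0 x1] := le_lt_trans Jx (ltry a).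
  by rewrite in_itv/= x1 ltW.
Qed.

End RateMinimum.

(** * Volume bounds in dimension n *)

Section DimensionBounds.
Context {R : realType}.
Variable p : R.
Hypothesis p2 : 2 <= p.
Let p0 : 0 < p. Proof. exact: lt_le_trans p2. Qed.

Definition pow_ball n : set (n.-tuple R) :=
  [set x | \sum_(i < n) `|tnth x i| `^ p <= n%:R].

Arguments pow_ball n _ : clear implicits.

Lemma dilate_lp_ball n :
  dilate (n.+1%:R `^ p^-1) (lp_ball p (n := n.+1)) = pow_ball n.+1.
Proof.
set c := n.+1%:R `^ p^-1.
have n0 : 0 < n.+1%:R :> R by rewrite ltr0n.
have c0 : 0 < c by rewrite powR_gt0.
have cp : c `^ p = n.+1%:R by rewrite -powRrM mulVf ?gt_eqF// powRr1// ltW.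
have scale b (y : R) : 0 < b -> `|b * y| `^ p = b `^ p * `|y| `^ p.
  by move=> b0; rewrite normrM gtr0_norm// (powRM _ (ltW b0) (normr_ge0 y)).
apply/seteqP; split => x.
  move=> [y yB <-]; rewrite /pow_ball /=.
  under eq_bigr do rewrite tnth_mktuple scale//.
  by rewrite -mulr_sumr cp ler_piMr// ltW.
move=> xN; exists [tuple c^-1 * tnth x i | i < n.+1].
  rewrite /lp_ball /=; under eq_bigr do rewrite tnth_mktuple scale ?invr_gt0//.
  rewrite -mulr_sumr -powR_inv1 ?(ltW c0)// -powRrM mulrC.
  have -> : c `^ (-1 * p) = n.+1%:R^-1 by rewrite mulN1r powRN cp.
  by rewrite ler_pdivrMr// mul1r.
apply: eq_from_tnth => i; rewrite !tnth_mktuple mulVKf// gt_eqF//.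
Qed.

Lemma prod_gexp n (x : n.-tuple R) t s : \prod_(i < n) gexp p t s (tnth x i) =
  expR (t * (\sum_(i < n) tnth x i ^+ 2) - s * (\sum_(i < n) `|tnth x i| `^ p)).
Proof. by rewrite /gexp -expR_sum sumrB -!mulr_sumr. Qed.

(** On the ball the indicator is at most exp ((n - sum |x_i|^p) / p), a single product. *)
Lemma pow_ball_volume_le n : (lebesgue_volume (pow_ball n) <=
  (expR (n%:R * log_volume_const p))%:E)%E.
Proof.
have [s0 gi] := legendre_dom0 p2.
have Z0 := Zexp0_gt0 p2.
have := @lebesgue_volume_le R unit n [:: tt] (fun=> expR (n%:R * p^-1))
  (fun=> gexp p 0 p^-1) (pow_ball n) (fun=> gi).
rewrite big_seq1 -/(Zexp p 0 p^-1) -{1}(lnK (x := Zexp p 0 p^-1)) ?posrE//.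
rewrite -expRM_natl -expRD -mulrDr; apply => x.
rewrite big_seq1 prod_gexp mul0r sub0r -expRD indicE.
case: (boolP (x \in _)) => [|_]; last by rewrite expR_ge0.
rewrite inE /pow_ball /= => xN; rewrite -[leLHS]expR0 ler_expR subr_ge0.
by rewrite [leRHS]mulrC ler_wpM2l// ltW// invr_gt0.
Qed.

Definition radius n (x : n.-tuple R) : R := l2norm x / Num.sqrt n%:R.

Lemma sqr_radius n (x : n.+1.-tuple R) :
  n.+1%:R * radius x ^+ 2 = \sum_(i < n.+1) tnth x i ^+ 2.
Proof.
have S0 : 0 <= \sum_(i < n.+1) tnth x i ^+ 2 by rewrite sumr_ge0// => i _; exact: sqr_ge0.
by rewrite /radius /l2norm exprMn exprVn !sqr_sqrtr// mulrCA divff ?mulr1.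
Qed.

Lemma radius_ge0 n (x : n.-tuple R) : 0 <= radius x.
Proof. by rewrite divr_ge0 ?sqrtr_ge0. Qed.

(** From u^2 <= 1 + |u|^p the squared radius is at most 2. This plays the role of exponential
    tightness: closed sets may be cut down to [0,2]. *)
Lemma radius_pow_ball n (x : n.+1.-tuple R) : pow_ball n.+1 x -> radius x <= 2.
Proof.
rewrite /pow_ball /= => xN.
have n0 : 0 < n.+1%:R :> R by rewrite ltr0n.
have : n.+1%:R * radius x ^+ 2 <= n.+1%:R * 2.
  rewrite sqr_radius mulr_natr (mulr2n n.+1%:R).
  apply: (@le_trans _ _ (\sum_(i < n.+1) (1 + `|tnth x i| `^ p))).
    by apply: ler_sum => i _; exact: sqr_le_1D_powR.
  by rewrite big_split /= sumr_const card_ord lerD.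
rewrite ler_pM2l// => r2.
rewrite leNgt; apply/negP => h; have : 2 * 2 < radius x ^+ 2.
  by rewrite expr2 ltr_pM.
by lra.
Qed.

(** The open sets where one Legendre term exceeds [a] cover the compact part of C. Where the term of
    j does so, the product of weights of j times [c j] is at least 1 on the ball. *)
Lemma closed_volume_le (C : set R) (a : R) : closed C ->
  (forall x, C x -> (a%:E < JX p x)%E) ->
  exists2 M, 0 < M & forall n,
    (lebesgue_volume [set x : n.+1.-tuple R | pow_ball n.+1 x /\ C (radius x)] <=
     (M * expR (n.+1%:R * (log_volume_const p - a)))%:E)%E.
Proof.
move=> clC Ca.
pose f (j : R * R) := [set y | a < legendre_term p j.1 j.2 (y ^+ 2)].
pose D : set (R * R) := [set j | legendre_dom p j.1 j.2].
have cK : compact (C `&` `[0, 2]%classic).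
  by rewrite setIC; apply: compact_closedI => //; exact: segment_compact.
rewrite compact_cover in cK.
have fo j : D j -> open (f j).
  move=> _; have /continuousP cf := @continuous_legendre_term R p j.1 j.2.
  by apply: (cf [set z | a < z]); exact: open_gt.
have cover : C `&` `[0, 2]%classic `<=` cover D f.
  move=> y [Cy /=]; rewrite in_itv/= => /andP[y0 _].
  have [t [s [dom H]]] := lt_JX p2 y0 (Ca y Cy).
  by exists (t, s).
have [D' D'D D'c] := cK _ D f fo cover.
(* The zero default makes every [g j] integrable, as [lebesgue_volume_le] asks; pairs of the
   subcover keep their true weight. *)
pose g (j : R * R) : R -> R :=
  if `[< integrableR (gexp p j.1 j.2) >] then gexp p j.1 j.2 else cst 0.
have gi j : integrableR (g j).
  by rewrite /g; case: asboolP => // _; exact: integrable0.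
have gE j : j \in D' -> g j = gexp p j.1 j.2.
  by move=> /D'D; rewrite inE => -[_ ji]; rewrite /g asboolT.
have Zj j : j \in D' -> 0 < Zexp p j.1 j.2.
  by move=> /D'D; rewrite inE => -[_ ji]; exact: Zexp_gt0.
(* The successor keeps M positive when the subcover is empty, so that ln M can be used later. *)
exists (size (enum_fset D')).+1%:R => [|n]; first exact: ltr0n.
set N := n.+1.
pose c (j : R * R) := expR (- (N%:R * (a - log_volume_const p + ln (Zexp p j.1 j.2)))).
have N0 : 0 < N%:R :> R by rewrite ltr0n.
have := @lebesgue_volume_le R (R * R)%type N (enum_fset D') c g
  [set x : N.-tuple R | pow_ball N x /\ C (radius x)] gi.
have -> : \sum_(j <- enum_fset D') c j * intR (g j) ^+ N =
    (size (enum_fset D'))%:R * expR (N%:R * (log_volume_const p - a)).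
  rewrite big_seq (eq_bigr (fun=> expR (N%:R * (log_volume_const p - a)))).
    by rewrite -big_seq big_const_seq count_predT iter_addr_0 [RHS]mulr_natl.
  move=> j jD'; rewrite gE// -/(Zexp _ _ _) -{1}(lnK (x := Zexp p j.1 j.2)) ?posrE ?Zj// /c.
  by rewrite -expRM_natl -expRD; congr expR; ring.
have le_size : (size (enum_fset D'))%:R * expR (N%:R * (log_volume_const p - a)) <=
    (size (enum_fset D')).+1%:R * expR (N%:R * (log_volume_const p - a)).
  by rewrite ler_wpM2r ?expR_ge0// ler_nat.
move=> H; apply: (le_trans (H _)); last by rewrite lee_fin.
move=> {H} x; rewrite indicE.
have term0 j : 0 <= c j * \prod_(i < N) g j (tnth x i).
  rewrite mulr_ge0 ?expR_ge0// prodr_ge0// => i _.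
  by rewrite /g; case: asboolP => // _; exact: gexp_ge0.
case: (boolP (x \in _)) => [|_]; last by rewrite sumr_ge0.
rewrite inE /= => -[xN xC].
have r2 := radius_pow_ball xN.
have [|j /= jD' fj] := D'c (radius x).
  by split => //=; rewrite in_itv/= radius_ge0.
rewrite (bigD1_seq j) ?fset_uniq//= -[leLHS]addr0 lerD ?sumr_ge0//.
rewrite gE// prod_gexp -expRD -[leLHS]expR0 ler_expR -sqr_radius.
have [s0 _] : D j by have := D'D _ jD'; rewrite inE.
move: fj; rewrite /f /= /legendre_term => fj.
have h1 : N%:R * a <= N%:R * (j.1 * radius x ^+ 2 - j.2 + log_volume_const p -
    ln (Zexp p j.1 j.2)) by rewrite ler_wpM2l// ltW.
have h2 : j.2 * (\sum_(i < N) `|tnth x i| `^ p) <= j.2 * N%:R by rewrite ler_wpM2l.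
move: h1 h2; rewrite -/N; move: (\sum_(i < N) _) (ln _) (log_volume_const p) => S A B.
by lra.
Qed.

Lemma shell_volume_ge x delta kappa : (JX p x < +oo)%E -> 0 < delta -> 0 < kappa ->
  \forall n \near \oo,
    ((expR (n%:R * (log_volume_const p - fine (JX p x) - kappa)))%:E <=
     lebesgue_volume (shell p (x ^+ 2) delta n))%E.
Proof.
move=> Jx d0 k0; have /andP[x0 x1] := JX_support Jx.
have Jfin : JX p x \is a fin_num by rewrite ge0_fin_numE// JX_ge0.
have y0 : 0 < x ^+ 2 by exact: exprn_gt0.
have [pE|pN2] := eqVneq p 2.
  have y01 : 0 < x ^+ 2 <= 1 by rewrite y0 exprn_ile1// ltW.
  have := shell_volume_ge_2 pE y01 d0 k0.
  have -> : fine (JX p x) = - ln x by rewrite /JX pE eqxx x0 x1.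
  have -> : ln (x ^+ 2) / 2 = ln x by rewrite lnXn// (mulr2n (ln x)); lra.
  by rewrite opprK.
have p2' : 2 < p by rewrite lt_neqAle eq_sym pN2.
have x1' : x < 1.
  by move: Jx; rewrite /JX (negbTE pN2); case: ifP => // /andP[].
have y01 : 0 < x ^+ 2 < 1 by rewrite y0 exprn_ilt1// ltW.
have [t [s [adm H]]] := shell_volume_ge_gt2 p2' y01 d0 k0.
apply: filterS H => n; apply: le_trans; rewrite lee_fin ler_expR ler_wpM2l//.
rewrite lerB// lerB// -lee_fin fineK//.
apply: legendre_term_le_JX => //; first exact: ltW.
split; last exact: integrableR_gexp.
by move: adm; rewrite /admissible (negbTE pN2) => /ltW.
Qed.

End DimensionBounds.

Arguments pow_ball {R} p n _.

(** * Upper and lower limits, and measurability of the radius *)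

Lemma limn_esup_le_near {R : realType} (u : nat -> \bar R) b :
  (\forall n \near \oo, (u n <= b)%E) -> (limn_esup u <= b)%E.
Proof.
move=> ub; apply: (@le_trans _ _ (ereal_sup [set u x | x in [set n | (u n <= b)%E]])).
  by apply: ereal_inf_lbound; exists [set n | (u n <= b)%E].
by apply: ge_ereal_sup => _ [n /= un <-].
Qed.

Lemma limn_einf_ge_near {R : realType} (u : nat -> \bar R) b :
  (\forall n \near \oo, (b <= u n)%E) -> (b <= limn_einf u)%E.
Proof.
move=> ub; rewrite /limn_einf leeNr; apply: limn_esup_le_near.
by apply: filterS ub => n; rewrite leeN2.
Qed.

Lemma near_succ (P : nat -> Prop) :
  (\forall n \near \oo, P n) -> \forall n \near \oo, P n.+1.
Proof. by move=> [N _ H]; exists N => // n /= Nn; apply: H; exact: leqW. Qed.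

Lemma borel_measurable {R : realType} (G : set R) : borel G -> measurable G.
Proof.
apply: smallest_sub; first exact: sigma_algebra_measurable.
by move=> A; exact: open_measurable.
Qed.

Lemma measurable_radius {R : realType} n :
  measurable_fun setT (fun x : n.-tuple R => radius x).
Proof.
apply: measurable_funM => //.
apply: (@measurableT_comp _ _ _ _ _ _ (fun y : R => Num.sqrt y)).
  by apply: continuous_measurable_fun; exact: sqrt_continuous.
apply: measurable_sum => i; apply: measurable_funX; exact: measurable_tnth.
Qed.

(** * The large deviation principle *)

Section UniformBallLDP.
Context {R : realType}.
Variables (p : R) (d : nat -> measure_display) (T : forall n, measurableType (d n)).
Variables (P : forall n, probability (T n) R) (X : forall n, {RV (P n) >-> n.+1.-tuple R}).
Hypothesis p2 : 2 <= p.
Hypothesis hX : forall n,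
  uniform_on (dilate (n.+1%:R `^ p^-1) (lp_ball p (n := n.+1))) (X n).

Let eta n (w : T n) : R := radius (X n w).
Let rate (G : set R) n : \bar R := ((n.+1%:R^-1)%:E * lne (P n (@eta n @^-1` G)))%E.
Let sector n (G : set R) : set (n.+1.-tuple R) :=
  [set x | pow_ball p n.+1 x /\ G (radius x)].

Lemma measurable_eta n G : borel G -> measurable (@eta n @^-1` G).
Proof.
move=> /borel_measurable mG.
rewrite -[_ @^-1` _]setTI; apply: (measurableT_comp (@measurable_radius R n.+1)) => //.
Qed.

(** Finiteness is the explicit upper bound; positivity is read off the uniform law, whose total mass
    would otherwise be 0. *)
Lemma pow_ball_volume n : exists2 v, 0 < v &
  lebesgue_volume (pow_ball p n.+1) = v%:E.
Proof.
have := hX (@measurableT _ (n.+1.-tuple R)); rewrite dilate_lp_ball// setTI.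
rewrite /distribution /pushforward preimage_setT probability_setT.
have := pow_ball_volume_le p2 n.+1; have := lebesgue_volume_ge0 (pow_ball p n.+1).
case: (lebesgue_volume _) => [v| |] //; rewrite lee_fin => v0 _ h.
exists v => //; rewrite lt_neqAle v0 andbT eq_sym; apply/eqP => vE.
by move: h; rewrite vE mul0e => -[] /eqP; rewrite oner_eq0.
Qed.

Lemma prob_eta n G : borel G -> P n (@eta n @^-1` G) =
  (lebesgue_volume (@sector n G) / lebesgue_volume (pow_ball p n.+1))%E.
Proof.
move=> /borel_measurable mG.
have mA : measurable [set x : n.+1.-tuple R | G (radius x)].
  by rewrite -[X in measurable X]setTI; exact: measurable_radius.
by have := hX mA; rewrite dilate_lp_ball// setIC.
Qed.

(** The shell around the minimiser, where the rate is 0, already has the full exponential volume. *)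
Lemma near_pow_ball_volume_ge kappa : 0 < kappa -> \forall n \near \oo,
  ((expR (n.+1%:R * (log_volume_const p - kappa)))%:E <=
   lebesgue_volume (pow_ball p n.+1))%E.
Proof.
move=> k0; have Jm : (JX p (mp p) < +oo)%E by rewrite JX_mp// ltry.
have := near_succ (shell_volume_ge p2 Jm ltr01 k0).
apply: filterS => n; rewrite JX_mp// subr0 => /le_trans; apply.
by apply: subset_lebesgue_volume => x [].
Qed.

Lemma limn_esup_rate_le (G : set R) (a : R) : borel G ->
  (forall x, closure G x -> (a%:E < JX p x)%E) ->
  (limn_esup (rate G) <= (- a)%:E)%E.
Proof.
move=> bG Ga; have [M M0 HM] := closed_volume_le p2 (@closed_closure _ G) Ga.
apply/lee_addgt0Pr => e e0; rewrite -EFinD; apply: limn_esup_le_near.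
have e2 : 0 < e / 2 by rewrite divr_gt0.
(* Half of e absorbs the size M of the subcover, the other half the estimate of the ball's
   volume. *)
have Mn : \forall n \near \oo, n.+1%:R^-1 * ln M <= e / 2.
  have : n.+1%:R^-1 * ln M @[n --> \oo] --> (0 : R).
    by rewrite -(mul0r (ln M)); apply: cvgMl; exact: cvg_harmonic.
  by move=> /cvgr0_norm_le/(_ _ e2); apply: filterS => n; apply: le_trans (ler_norm _).
apply: filterS2 Mn (near_pow_ball_volume_ge e2) => n Mn; rewrite /rate prob_eta//.
have [v v0 vE] := pow_ball_volume n; have vV : (v%:E^-1 = v^-1%:E)%E by rewrite inver gt_eqF.
rewrite vE vV lee_fin => vge.
set N := n.+1; have N0 : 0 < N%:R :> R by rewrite ltr0n.
pose m := M * expR (N%:R * (log_volume_const p - a)).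
have m0 : 0 < m by rewrite mulr_gt0// expR_gt0.
have Vm : (lebesgue_volume (@sector n G) <= m%:E)%E.
  apply: (le_trans (subset_lebesgue_volume _) (HM n)).
  by move=> x [? ?]; split => //; exact: subset_closure.
have := lebesgue_volume_ge0 (@sector n G); move: (lebesgue_volume _) Vm => W Vm W0.
have lnv : N%:R * (log_volume_const p - e / 2) <= ln v.
  by rewrite -ler_expR lnK ?posrE.
have NV0 : 0 <= N%:R^-1 :> R by rewrite invr_ge0 ltW.
apply: (@le_trans _ _ ((N%:R^-1)%:E * lne (m / v)%:E)%E).
  apply: lee_wpmul2l; first by rewrite lee_fin.
  rewrite lee_lne.
  - by rewrite EFinM; apply: lee_wpmul2r; rewrite ?lee_fin ?invr_ge0// ltW.
  - by rewrite in_itv/= leey andbT mule_ge0// lee_fin invr_ge0 ltW.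
  - by rewrite in_itv/= leey andbT lee_fin divr_ge0// ltW.
rewrite lne_EFin ?divr_gt0// -EFinM lee_fin ln_div ?posrE//.
rewrite /m lnM ?posrE ?expR_gt0// expRK.
have : N%:R^-1 * (N%:R * (log_volume_const p - e / 2)) <= N%:R^-1 * ln v.
  by rewrite ler_wpM2l.
have K (z : R) : N%:R^-1 * (N%:R * z) = z by rewrite mulKf// gt_eqF.
rewrite K => h; rewrite mulrBr mulrDr K.
move: Mn h; rewrite -/N; move: (_ * ln M) (_ * ln v) (log_volume_const p) => A B C'; lra.
Qed.

Lemma limn_einf_rate_ge (G : set R) x : borel G -> G° x ->
  (- JX p x <= limn_einf (rate G))%E.
Proof.
move=> bG Gx; have [Jx|] := boolP (JX p x < +oo)%E; last first.
  by rewrite -leNgt leye_eq => /eqP ->; rewrite leNye.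
have /andP[x0 _] := JX_support Jx.
have Jfin : JX p x \is a fin_num by rewrite ge0_fin_numE// JX_ge0.
(* Shells control the squared radius; as x > 0, continuity of the square root at x^2 transfers the
   neighbourhood of x. *)
have [delta delta0 Hd] : exists2 delta : R, 0 < delta &
    forall y, `|y - x ^+ 2| <= delta -> G (Num.sqrt y).
  have : nbhs (x ^+ 2) (Num.sqrt @^-1` G).
    have cs := @sqrt_continuous R (x ^+ 2); apply: cs.
    by rewrite sqrtr_sqr gtr0_norm.
  move=> /nbhs_ballP[e /= e0 He]; exists (e / 2); first by rewrite divr_gt0.
  move=> y hy; apply: He; rewrite /ball/= distrC (le_lt_trans hy)//.
  by rewrite ltr_pdivrMr// ltr_pMr// ltr1n.
rewrite -(fineK Jfin) -EFinN; apply/lee_subgt0Pr => e e0.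
rewrite -EFinB; apply: limn_einf_ge_near.
apply: filterS (near_succ (shell_volume_ge p2 Jx delta0 e0)) => n.
rewrite /rate prob_eta//; have [v v0 vE] := pow_ball_volume n; have vV : (v%:E^-1 = v^-1%:E)%E by rewrite inver gt_eqF.
rewrite vE vV => Hn.
set N := n.+1; have N0 : 0 < N%:R :> R by rewrite ltr0n.
have vle : v <= expR (N%:R * log_volume_const p).
  by rewrite -lee_fin -vE; exact: pow_ball_volume_le.
set E1 := expR _ in Hn.
have sub : shell p (x ^+ 2) delta N `<=` @sector n G.
  move=> z [zN zS]; split => //.
  rewrite -(ger0_norm (radius_ge0 z)) -sqrtr_sqr; apply: Hd.
  move: zS; rewrite -sqr_radius -mulrBr normrM gtr0_norm// ler_pM2l//.
have Vge := le_trans Hn (subset_lebesgue_volume sub).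
have := lebesgue_volume_ge0 (@sector n G); move: (lebesgue_volume _) Vge => W Vge W0.
have E1v : 0 < E1 / v by rewrite divr_gt0 ?expR_gt0.
apply: (@le_trans _ _ ((N%:R^-1)%:E * lne (E1 / v)%:E)%E); last first.
  apply: lee_wpmul2l; first by rewrite lee_fin invr_ge0 ltW.
  rewrite lee_lne.
  - by rewrite EFinM; apply: lee_wpmul2r; rewrite ?lee_fin ?invr_ge0// ltW.
  - by rewrite in_itv/= leey andbT lee_fin ltW.
  - by rewrite in_itv/= leey andbT mule_ge0// lee_fin invr_ge0 ltW.
rewrite lne_EFin// -EFinM lee_fin ln_div ?posrE ?expR_gt0// expRK.
have lnv : ln v <= N%:R * log_volume_const p by rewrite -ler_expR lnK ?posrE.
rewrite -(ler_pM2l N0) mulrA divff ?mul1r; last by rewrite gt_eqF.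
by rewrite -/N; lra.
Qed.

Lemma eta_ldp : satisfies_ldp P eta (fun n => n.+1%:R) (JX p).
Proof.
split.
- exact: uniform_regular.
- split=> [n|]; first by rewrite ltr0n.
  apply/cvgryPge => A; exists (Num.truncn `|A|) => // n /= An.
  rewrite (le_trans (ler_norm A))//.
  have /andP[_ /ltW h] := truncn_itv (normr_ge0 A).
  by rewrite (le_trans h)// ler_nat.
- by move=> n G; exact: measurable_eta.
- by split; [exact: JX_ge0|exact: lower_semicontinuous_JX].
move=> G bG; split; first last.
- set I := ereal_inf _.
  have I0 : (0 <= I)%E by apply/ereal_infP => _ [x _ <-]; exact: JX_ge0.
  (* The covering argument needs a level strictly below the infimum; letting a increase to I handles
     finite and infinite I. *)
  have upper a : (a%:E < I)%E -> (limn_esup (rate G) <= (- a)%:E)%E.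
    move=> aI; apply: limn_esup_rate_le => // x Gx.
    by rewrite (lt_le_trans aI)//; apply: ereal_inf_lbound; exists x.
  case: I I0 upper => [r _ upper| _ upper|//].
    rewrite -EFinN; apply/lee_addgt0Pr => e e0.
    have := upper (r - e); rewrite lte_fin gtrBl => /(_ e0).
    by rewrite opprB addrC EFinD.
  rewrite /= leeNy_eq; case E : (limn_esup (rate G)) => [l| |//].
    have := upper (1 - l); rewrite ltry => /(_ isT).
    by rewrite E lee_fin; lra.
  by have := upper 0; rewrite ltry => /(_ isT); rewrite E.
- exact: limn_einf_sup.
- rewrite leeNl; apply/ereal_infP => _ [x Gx <-].
  by rewrite leeNl; exact: limn_einf_rate_ge.
Qed.

End UniformBallLDP.

Theorem proposition3p7 (R : realType) (p : R) (hp : 2 <= p)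
    (d : nat -> measure_display) (T : forall n : nat, measurableType (d n))
    (P : forall n : nat, probability (T n) R)
    (X : forall n : nat, {RV (P n) >-> n.+1.-tuple R})
    (hX : forall n : nat,
       uniform_on (dilate (n.+1%:R `^ p^-1) (lp_ball p (n := n.+1))) (X n)) :
  satisfies_ldp_grf P
    (fun (n : nat) (w : T n) => l2norm (X n w) / Num.sqrt n.+1%:R)
    (fun n : nat => n.+1%:R)
    (JX p) /\
  [set x : R | forall y : R, (JX p x <= JX p y)%E] = [set mp p].
Proof.
split; last exact: JX_argmin.
by split; [exact: eta_ldp|exact: compact_level_sets_JX].
Qed.
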